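(* Let $\nu(dx)=e^{-W(x)}dx$ be a probability measure on $\mathbb R^d$ with $W\in C^1$, and $L_W=\Delta-\nabla W\cdot\nabla$. Assume there exist constants $b,R>0$, a positive continuous function $\phi$ and a $C^2$ function $F\ge1$ with $\frac{L_WF}{F}\le-\phi+b\mathbf 1_{B(0,R)}$. Let $U$ be smooth such that $\mu=e^{-U}\nu$ is a probability measure, and assume that $\phi_U(x)=\phi(x)+\frac{\langle\nabla U(x),\nabla F(x)\rangle}{F(x)}>0$ for all $|x|$ large enough. Set $h_U(r)=e^{-\inf_{\{\phi_U\le1/r\}}U}\,\nu(\phi_U\le1/r)$. Then there exists a constant $C>0$ such that $\mu$ satisfies a weak Poincaré inequality with rate $\beta_\mu(s)=C\,h_U^{-1}(s)$.
   Context: A probability measure $\mu$ on $\mathbb R^d$ satisfies a weak Poincaré inequality with rate $\beta_\mu$ if $\beta_\mu:(0,\infty)\to(0,\infty]$ is non-increasing and for all $s>0$ and all smooth bounded $f$, $\mathrm{Var}_\mu(f)\le \beta_\mu(s)\int|\nabla f|^2d\mu+s\,\mathrm{Osc}^2(f)$, where $\mathrm{Osc}(f)=\sup f-\inf f$. $h_U^{-1}$ denotes the generalized inverse of the non-increasing function $h_U$.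
   Formalization: The rate is only required to take values in [0,∞] instead of (0,∞], because C·h_U^{-1}(s) equals 0 for large s when U is bounded below (e.g. U = 0 and s ≥ 1), with the convention 0·∞ = 0 in the inequality. *)

(* Defs.v *)
From HB Require Import structures.
From mathcomp Require Import all_boot all_order all_algebra.
From mathcomp Require Import all_classical all_reals all_analysis.
Set Implicit Arguments. Unset Strict Implicit. Unset Printing Implicit Defensive.
Import Order.TTheory GRing.Theory Num.Theory.
Import numFieldNormedType.Exports.
Local Open Scope classical_set_scope.
Local Open Scope ring_scope.

Definition enorm (R : realType) (d : nat) (x : 'rV[R]_d) : R :=
  Num.sqrt (\sum_(i < d) x 0 i ^+ 2).

Definition partial (R : realType) (d : nat) (i : 'I_d) (f : 'rV[R]_d -> R)
  : 'rV[R]_d -> R := fun x => 'D_(delta_mx 0 i) f x.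

Definition grad (R : realType) (d : nat) (f : 'rV[R]_d -> R) (x : 'rV[R]_d)
  : 'rV[R]_d := \row_i partial i f x.

Definition laplacian (R : realType) (d : nat) (f : 'rV[R]_d -> R)
  (x : 'rV[R]_d) : R := \sum_(i < d) partial i (partial i f) x.

Definition dotp (R : realType) (d : nat) (u v : 'rV[R]_d) : R :=
  \sum_(i < d) u 0 i * v 0 i.

Fixpoint Ck (R : realType) (d : nat) (k : nat) (f : 'rV[R]_d -> R) : Prop :=
  continuous f /\
  match k with
  | 0 => True
  | k'.+1 => forall i : 'I_d,
      (forall x, derivable f x (delta_mx 0 i)) /\ Ck k' (partial i f)
  end.

Definition smooth (R : realType) (d : nat) (f : 'rV[R]_d -> R) : Prop :=
  forall k, Ck k f.

(* Lebesgue integral of a nonnegative (extended-real valued) function on R^d,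
   defined as the iterated integral w.r.t. one-dimensional Lebesgue measure
   (equal to the integral w.r.t. d-dimensional Lebesgue measure by Tonelli). *)
Fixpoint lint (R : realType) (d : nat) : ('rV[R]_d -> \bar R) -> \bar R :=
  match d return ('rV[R]_d -> \bar R) -> \bar R with
  | 0 => fun f => f 0
  | d'.+1 => fun f =>
      (\int[@lebesgue_measure R]_(t in setT)
          lint (fun y : 'rV[R]_d' => f (row_mx (const_mx t : 'rV[R]_1) y)))%E
  end.

Definition lintR (R : realType) (d : nat) (f : 'rV[R]_d -> R) : \bar R :=
  (lint (fun x => (Num.max (f x) 0)%:E) - lint (fun x => (Num.max (- f x) 0)%:E))%E.

Definition dmeasure (R : realType) (d : nat) (rho : 'rV[R]_d -> R)
  (A : set 'rV[R]_d) : \bar R :=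
  lint (fun x => ((\1_A x : R) * rho x)%:E).

Definition dmean (R : realType) (d : nat) (rho f : 'rV[R]_d -> R) : R :=
  fine (lintR (fun x => f x * rho x)).

Definition dvar (R : realType) (d : nat) (rho f : 'rV[R]_d -> R) : \bar R :=
  lint (fun x => ((f x - dmean rho f) ^+ 2 * rho x)%:E).

Definition denergy (R : realType) (d : nat) (rho f : 'rV[R]_d -> R) : \bar R :=
  lint (fun x => (enorm (grad f x) ^+ 2 * rho x)%:E).

Definition osc (R : realType) (d : nat) (f : 'rV[R]_d -> R) : \bar R :=
  (ereal_sup (range (fun x => (f x)%:E)) - ereal_inf (range (fun x => (f x)%:E)))%E.

Definition weak_poincare (R : realType) (d : nat) (rho : 'rV[R]_d -> R)
  (beta : R -> \bar R) : Prop :=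
  (forall s t : R, 0 < s -> s <= t -> (beta t <= beta s)%E) /\
  (forall s : R, 0 < s -> (0 <= beta s)%E) /\
  (forall s : R, 0 < s -> forall f : 'rV[R]_d -> R,
     smooth f -> (exists M : R, forall x, `|f x| <= M) ->
     (dvar rho f <= beta s * denergy rho f + s%:E * (osc f * osc f))%E).

Definition geninv (R : realType) (h : R -> \bar R) (s : R) : \bar R :=
  ereal_inf [set r%:E | r in [set r : R | 0 < r /\ (h r <= s%:E)%E]].

(* Main.v *)
(* With V = U + W, the Lyapunov condition says L_V F / F <= - phiU + b 1_Q for
   L_V = Delta - grad V . grad and a large box Q.  Outside S = {phiU <= 1/r}
   one has (f - c)^2 <= r phiU^+ (f - c)^2, and
     int - (L_V F / F) g^2 dmu <= int |grad g|^2 dmu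
   for compactly supported g: integrate the divergence of
   exp(- V) (g^2 / F) grad F.  With g a truncation of f - c, what remains is
   int_Q (f - c)^2 dmu, bounded by the Poincare inequality of the box for a
   suitable c = f(y); since c is a value of f, the part over S costs at most
   Osc(f)^2 mu(S) <= Osc(f)^2 h_U(r).  Hence
     Var(f) <= C r int |grad f|^2 dmu + h_U(r) Osc(f)^2,
   and one optimizes over the r with h_U(r) <= s. *)
Require Import Defs.
From HB Require Import structures.
From mathcomp Require Import all_boot all_order all_algebra.
From mathcomp Require Import all_classical all_reals all_analysis.
From mathcomp Require Import measurable_realfun lra ring.
Import Order.TTheory GRing.Theory Num.Theory.
Import numFieldNormedType.Exports.
Local Open Scope classical_set_scope.
Local Open Scope ring_scope.
Set Implicit Arguments. Unset Strict Implicit. Unset Printing Implicit Defensive.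

(** The integrals of the statement are iterated one-dimensional ones, so a Borel measure [lebRV] on
    row vectors is built by the same recursion; on nonnegative measurable functions it gives back
    [lint], which makes Fubini and dominated convergence available. Nothing controls [grad F] at
    infinity, so the divergence theorem is applied to compactly supported test functions only;
    boundedness of [f] keeps the truncation error at [O(1/N^2)] plus a tail mass. The constant is
    [2 + (b + K) * kappa]: the 2 comes from [(u + v)^2 <= 2 u^2 + 2 v^2] when the truncation is
    differentiated, [K] bounds [phiU] on the box, where it may be negative, and [kappa] is the
    Poincare constant of the box for the density of mu. None of them depends on [r], which is why
    [r] can be chosen last. The generalized inverse is an infimum that need not be attained, so both
    [r] and the energy are approached strictly from above. *)

Section continuity.
Context (R : realType).

Lemma continuous_oppr (T : topologicalType) (f : T -> R) :
  continuous f -> continuous (fun x => - f x).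
Proof. by move=> cf x; exact: (cvgN (cf x)). Qed.

Lemma continuous_addr (T : topologicalType) (f g : T -> R) :
  continuous f -> continuous g -> continuous (fun x => f x + g x).
Proof. by move=> cf cg x; exact: (cvgD (cf x) (cg x)). Qed.

Lemma continuous_mulr (T : topologicalType) (f g : T -> R) :
  continuous f -> continuous g -> continuous (fun x => f x * g x).
Proof. by move=> cf cg x; exact: (cvgM (cf x) (cg x)). Qed.

Lemma continuous_subc (T : topologicalType) (f : T -> R) c :
  continuous f -> continuous (fun x => f x - c).
Proof. by move=> cf x; exact: (cvgB (cf x) (cvg_cst _)). Qed.

Lemma continuous_csubr (T : topologicalType) (f : T -> R) c :
  continuous f -> continuous (fun x => c - f x).
Proof. by move=> cf x; exact: (cvgB (cvg_cst _) (cf x)). Qed.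

Lemma continuous_sqr (T : topologicalType) (f : T -> R) :
  continuous f -> continuous (fun x => f x ^+ 2).
Proof.
move=> cf x; apply: (@continuous_comp _ _ _ f (fun z : R => z ^+ 2)).
  exact: cf.
exact: exprn_continuous.
Qed.

Lemma continuous_invr (T : topologicalType) (f : T -> R) :
  continuous f -> (forall x, f x != 0) -> continuous (fun x => (f x)^-1).
Proof.
move=> cf f0 x; apply: (@continuous_comp _ _ _ f (fun z : R => z^-1)).
  exact: cf.
exact: inv_continuous.
Qed.

Lemma continuous_sum (T : topologicalType) n (f : 'I_n -> T -> R) :
  (forall i, continuous (f i)) -> continuous (fun x => \sum_i f i x).
Proof.
by move=> cf; apply: continuous_big => //; exact: add_continuous.
Qed.

Lemma continuous_pos : continuous (fun u : R => Num.max 0 u).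
Proof. by move=> u; apply: (@continuous_max _ _ (cst 0) id); [exact: cst_continuous|exact: id]. Qed.

End continuity.

(** * The Borel sigma-algebra and Lebesgue measure of R^d *)

Lemma cvg_row (R : realType) (T : Type) (F : set_system T) d
    (f : T -> 'rV[R]_d) (l : 'rV[R]_d) : Filter F ->
  (forall i, f x 0 i @[x --> F] --> l 0 i) -> f x @[x --> F] --> l.
Proof.
move=> FF fl A [P lP PA]; rewrite /nbhs /=.
have H : F (fun x => forall i j, P i j (f x i j)).
  apply: filter_forall => i; apply: filter_forall => j.
  by rewrite (ord1 i); apply: fl; rewrite -(ord1 i).
by apply: filterS H => x Hx; exact: PA.
Qed.

Definition borelRV (R : realType) d := g_sigma_algebraType (@open 'rV[R]_d).

Section borel.
Context (R : realType).

Lemma open_borel d (A : set 'rV[R]_d) : open A -> measurable (A : set (borelRV R d)).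
Proof. exact: sub_sigma_algebra. Qed.

Lemma closed_borel d (A : set 'rV[R]_d) :
  closed A -> measurable (A : set (borelRV R d)).
Proof.
move=> cA; rewrite -(setCK A); apply: measurableC.
by apply: open_borel; exact: closed_openC.
Qed.

Lemma continuous_borel d (f : 'rV[R]_d -> R) : continuous f ->
  measurable_fun [set: borelRV R d] f.
Proof.
move=> /continuousP cf; apply: (measurability _ (RGenOpens.measurableE R)).
move=> _ [_ [a [b ->] <-]]; rewrite setTI; apply: open_borel.
exact/cf/interval_open.
Qed.

(** The row is spelled exactly as in the recursive call of [lint], so that unfolding [lint] exposes
    this map by conversion. *)
Definition consRV d (p : R * 'rV[R]_d) : 'rV[R]_d.+1 :=
  row_mx (const_mx p.1 : 'rV[R]_1) p.2.

Lemma consRV0 d p : consRV p 0 (ord0 : 'I_d.+1) = p.1.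
Proof.
by rewrite /consRV mxE; case: splitP => j //= _; rewrite mxE.
Qed.

Lemma consRVS d p (j : 'I_d) : consRV p 0 (lift ord0 j) = p.2 0 j.
Proof.
rewrite /consRV mxE; case: splitP => k /=; first by rewrite (ord1 k).
by rewrite /bump/= !add1n => -[jk]; congr (_ _ _); apply: val_inj.
Qed.

Lemma coord_cvg d (i : 'I_d) (y : 'rV[R]_d) : z 0 i @[z --> y] --> y 0 i.
Proof. exact: coord_continuous. Qed.

Lemma consRV_continuous d : continuous (@consRV d).
Proof.
move=> p; apply: cvg_row => i.
have [->|[j ->]] : i = ord0 \/ exists j, i = lift ord0 j.
  by have [j|] := unliftP ord0 i; [move=> ->; right; exists j|left].
- rewrite consRV0; under eq_cvg do rewrite consRV0; exact: cvg_fst.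
- rewrite consRVS; under eq_cvg do rewrite consRVS.
  by apply: (@cvg_comp _ _ _ snd (fun y : 'rV[R]_d => y 0 j) _ _ _ cvg_snd);
    exact: coord_cvg.
Qed.

(** Second countability: the products of balls with rational centres and radius [1/(k+1)] that lie
    in [A] are countably many and cover it. This is what makes [consRV] measurable for the product
    sigma-algebra. *)
Lemma open_measurable_prod d (A : set (R * 'rV[R]_d)) : open A ->
  measurable (A : set (measurableTypeR R * borelRV R d)).
Proof.
move=> oA.
pose box (u : rat * 'rV[rat]_d * nat) : set (R * 'rV[R]_d) :=
  ball (ratr u.1.1 : R) u.2.+1%:R^-1 `*` ball (map_mx ratr u.1.2 : 'rV[R]_d) u.2.+1%:R^-1.
rewrite (_ : A = \bigcup_u (if `[< box u `<=` A >] then box u else set0)).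
  apply: countable_bigcupT_measurable; first exact: countableP.
  move=> u; case: asboolP => _; last exact: measurable0.
  apply: measurableX; first by apply: open_measurable; exact: ball_open.
  by apply: open_borel; exact: ball_open.
apply/seteqP; split; last by move=> p [u _]; case: asboolP => [uA|_ []//]; exact: uA.
move=> [t y] Aty.
(* Once [1/(k+1) < e/2], every box of that radius containing [(t, y)] lies in the [e]-ball around
   it, by the triangle inequality through the rational centre. *)
have /nbhs_ballP[e /= e0 eA] : nbhs (t, y) A by exact: open_nbhs_nbhs.
have [k ke] : exists k, k.+1%:R^-1 < e / 2.
  have := near_infty_natSinv_lt (PosNum (divr_gt0 e0 (ltr0n _ 2))).
  by move=> [k _ /(_ k (leqnn k))]; exists k.
have k0 : 0 < k.+1%:R^-1 :> R by rewrite invr_gt0.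
have rat_near (x : R) : exists q : rat, `|x - ratr q| < k.+1%:R^-1.
  have [|q] := @rat_in_itvoo _ (x - k.+1%:R^-1) (x + k.+1%:R^-1).
    by rewrite ltrBlDr -addrA ltrDl addr_gt0.
  rewrite in_itv/= => /andP[h1 h2]; exists q; rewrite ltr_norml.
  by apply/andP; split; [rewrite ltrNl opprB ltrBlDl | rewrite ltrBlDl -ltrBlDr].
have [q tq] := rat_near t.
have [v yv] := boolp.choice (fun i : 'I_d => rat_near (y 0 i)).
exists (q, \row_i v i, k) => //.
have ballv : ball (map_mx ratr (\row_i v i) : 'rV[R]_d) k.+1%:R^-1 y.
  split => // i j; rewrite (ord1 i) !mxE; apply: ball_sym; exact: yv.
case: asboolP => [_|]; first by split => //=; apply: ball_sym.
case=> -[s z] [/= qs vz]; apply: eA; split => /=.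
- apply: (@le_ball _ _ _ (k.+1%:R^-1 + k.+1%:R^-1)).
    by rewrite [e]splitr lerD// ltW.
  by apply: ball_triangle qs.
- apply: (@le_ball _ _ _ (k.+1%:R^-1 + k.+1%:R^-1)).
    by rewrite [e]splitr lerD// ltW.
  by apply: (ball_triangle _ vz); apply: ball_sym.
Qed.

Lemma measurable_consRV d : measurable_fun
  [set: measurableTypeR R * borelRV R d] (@consRV d : _ -> borelRV R d.+1).
Proof.
apply: (@measurability _ _ _ (borelRV R d.+1) _ _ (@open 'rV[R]_d.+1)) => //.
move=> _ [A oA <-]; rewrite setTI; apply: open_measurable_prod.
by move: A oA; apply/continuousP; exact: consRV_continuous.
Qed.

End borel.

Section lebesgueRV.
Context (R : realType).

Section cons_measure.
Context d (m : {sigma_finite_measure set (borelRV R d) -> \bar R}).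

(** Pushing the product measure forward puts it on row vectors themselves, so that the construction
    can be iterated in [d]. *)
Definition cons_measure : set (borelRV R d.+1) -> \bar R :=
  pushforward (@lebesgue_measure R \x m)%E (@consRV R d : _ -> borelRV R d.+1).

Let cons_measure0 : cons_measure set0 = 0%E.
Proof. by rewrite /cons_measure /pushforward preimage_set0 measure0. Qed.

Let cons_measure_ge0 A : (0 <= cons_measure A)%E.
Proof. by rewrite /cons_measure /pushforward; exact: measure_ge0. Qed.

Let cons_measure_additive : semi_sigma_additive cons_measure.
Proof.
move=> F mF tF mUF; rewrite /cons_measure /pushforward preimage_bigcup.
apply: measure_semi_sigma_additive.
- by move=> n; rewrite -[X in measurable X]setTI; exact: (measurable_consRV measurableT (mF n)).
- apply/trivIsetP => /= i j _ _ ij; rewrite -preimage_setI.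
  by move/trivIsetP : tF => /(_ _ _ _ _ ij) ->//; rewrite preimage_set0.
- rewrite -preimage_bigcup -[X in measurable X]setTI.
  exact: (measurable_consRV measurableT mUF).
Qed.

HB.instance Definition _ := isMeasure.Build _ _ _ cons_measure
  cons_measure0 cons_measure_ge0 cons_measure_additive.

Lemma rsubmx_continuous : continuous (fun x : 'rV[R]_d.+1 => @rsubmx R 1 1 d x).
Proof.
move=> x; apply: (@cvg_row _ _ (nbhs x)) => i; rewrite mxE.
under eq_cvg do rewrite mxE.
exact: coord_cvg.
Qed.

Lemma measurable_rsubmx : measurable_fun [set: borelRV R d.+1]
  ((fun x : 'rV[R]_d.+1 => @rsubmx R 1 1 d x) : _ -> borelRV R d).
Proof.
apply: (@measurability _ _ _ (borelRV R d) _ _ (@open 'rV[R]_d)) => //.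
move=> _ [A oA <-]; rewrite setTI; apply: open_borel.
by move: A oA; apply/continuousP; exact: rsubmx_continuous.
Qed.

Lemma measurable_coord n (i : 'I_n) :
  measurable_fun [set: borelRV R n] (fun x : 'rV[R]_n => x 0 i).
Proof. by apply: continuous_borel => x; exact: coord_cvg. Qed.

Lemma rsubmx_consRV p : @rsubmx R 1 1 d (consRV p) = p.2.
Proof. exact: row_mxKr. Qed.

Lemma cons_measureX (A : set R) (B : set 'rV[R]_d) :
  measurable (A : set (measurableTypeR R)) -> measurable (B : set (borelRV R d)) ->
  cons_measure [set x : 'rV[R]_d.+1 | A (x 0 ord0) /\ B (@rsubmx R 1 1 d x)] =
  (lebesgue_measure A * m B)%E.
Proof.
move=> mA mB; rewrite -product_measure1E// /cons_measure /pushforward.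
congr (product_measure1 _ _ _); apply/seteqP.
by split => -[t y] /=; rewrite consRV0 rsubmx_consRV.
Qed.

Let cons_measure_sigma_finite : sigma_finite setT cons_measure.
Proof.
have /sigma_finiteP[F [TF ndF Foo]] := sigma_finiteT m.
have /sigma_finiteP[G [TG ndG Goo]] := sigma_finiteT (@lebesgue_measure R).
exists (fun n => [set x : 'rV[R]_d.+1 | G n (x 0 ord0) /\ F n (@rsubmx R 1 1 d x)]).
  apply/seteqP; split => // x _.
  have [i _ Gi] : (\bigcup_i G i) (x 0 ord0) by rewrite -TG.
  have [j _ Fj] : (\bigcup_i F i) (@rsubmx R 1 1 d x) by rewrite -TF.
  exists (maxn i j) => //; split.
  - by move: Gi; exact/subsetPset/ndG/leq_maxl.
  - by move: Fj; exact/subsetPset/ndF/leq_maxr.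
move=> k; have [mF Fk] := Foo k; have [mG Gk] := Goo k; split.
  apply: (@measurableI _ (borelRV R d.+1)
    [set x : 'rV[R]_d.+1 | G k (x 0 ord0)] [set x : 'rV[R]_d.+1 | F k (@rsubmx R 1 1 d x)]).
    by rewrite -[X in measurable X]setTI; exact: measurable_coord.
  by rewrite -[X in measurable X]setTI; exact: measurable_rsubmx.
by rewrite cons_measureX// lte_mul_pinfty// ge0_fin_numE.
Qed.

HB.instance Definition _ := Measure_isSigmaFinite.Build _ _ _ cons_measure
  cons_measure_sigma_finite.

Lemma ge0_integral_cons (f : 'rV[R]_d.+1 -> \bar R) :
  measurable_fun [set: borelRV R d.+1] f -> (forall x, 0 <= f x)%E ->
  (\int[cons_measure]_x f x =
   \int[lebesgue_measure]_t \int[m]_y f (consRV (t, y)))%E.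
Proof.
move=> mf f0; rewrite (ge0_integral_pushforward (@measurable_consRV R d))//.
rewrite preimage_setT.
pose g : measurableTypeR R * borelRV R d -> \bar R := f \o @consRV R d.
have mg : measurable_fun setT g.
  exact: (measurableT_comp mf (@measurable_consRV R d)).
exact: (fubini_tonelli1 g mg (fun p => f0 _)).
Qed.

(** Both Tonelli orders serve in the box inequality: outer [t] to select a slice, outer [y] to
    integrate the one-dimensional energies. *)
Lemma ge0_integral_cons_swap (f : 'rV[R]_d.+1 -> \bar R) :
  measurable_fun [set: borelRV R d.+1] f -> (forall x, 0 <= f x)%E ->
  (\int[cons_measure]_x f x =
   \int[m]_y \int[lebesgue_measure]_t f (consRV (t, y)))%E.
Proof.
move=> mf f0; rewrite (ge0_integral_pushforward (@measurable_consRV R d))//.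
rewrite preimage_setT.
pose g : measurableTypeR R * borelRV R d -> \bar R := f \o @consRV R d.
have mg : measurable_fun setT g.
  exact: (measurableT_comp mf (@measurable_consRV R d)).
exact: (fubini_tonelli2 g mg (fun p => f0 _)).
Qed.

End cons_measure.

(** Lebesgue measure of dimension [d]. The Dirac mass at the only point of dimension 0 matches the
    base case of [lint]; the packed sigma-finite type is what Tonelli requires at the next step of
    the recursion. *)
Fixpoint lebRV d : {sigma_finite_measure set (borelRV R d) -> \bar R} :=
  match d with
  | 0 => @dirac _ (borelRV R 0) (0 : 'rV[R]_0) R
  | d'.+1 => cons_measure (lebRV d')
  end.

Lemma integral_lebRV0 (f : 'rV[R]_0 -> \bar R) :
  measurable_fun [set: borelRV R 0] f -> (\int[lebRV 0]_x f x = f 0%R)%E.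
Proof.
by move=> mf; rewrite integral_dirac// diracT mul1e.
Qed.

Lemma measurable_consRVr d (t : R) :
  measurable_fun [set: borelRV R d] ((fun y => consRV (t, y)) : _ -> borelRV R d.+1).
Proof. exact: measurableT_comp (@measurable_consRV R d) (measurable_pair1 t). Qed.

(** The bridge between the statement and measure theory: one use of Tonelli per dimension. *)
Lemma lint_lebRV d (f : 'rV[R]_d -> \bar R) :
  measurable_fun [set: borelRV R d] f -> (forall x, 0 <= f x)%E ->
  lint f = (\int[lebRV d]_x f x)%E.
Proof.
elim: d f => [|d IH] f mf f0; first by rewrite integral_lebRV0.
rewrite ge0_integral_cons//=; apply: eq_integral => t _; rewrite IH//.
exact: measurableT_comp (measurable_consRVr t).
Qed.

End lebesgueRV.

(** * Slices and one-dimensional estimates *)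

Section calculus.
Context (R : realType).

(** [Ck] speaks of directional derivatives only. Along an affine map the difference quotients are
    equal as functions of [h], so derivability and the derivative both transfer to slices without
    Frechet differentiability. *)
Lemma growth_rate_affine (V W : normedModType R) (f : W -> R) (phi : V -> W) x v w :
  (forall h : R, phi (h *: v + x) = h *: w + phi x) ->
  (fun h : R => h^-1 *: (((f \o phi) \o shift x) (h *: v) - (f \o phi) x)) =
  (fun h : R => h^-1 *: ((f \o shift (phi x)) (h *: w) - f (phi x))).
Proof. by move=> phiE; apply/funext => h /=; rewrite phiE. Qed.

Lemma derive_affine (V W : normedModType R) (f : W -> R) (phi : V -> W) x v w :
  (forall h : R, phi (h *: v + x) = h *: w + phi x) ->
  'D_v (f \o phi) x = 'D_w f (phi x).
Proof. by move=> /growth_rate_affine E; rewrite /derive E. Qed.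

Lemma derivable_affine (V W : normedModType R) (f : W -> R) (phi : V -> W) x v w :
  (forall h : R, phi (h *: v + x) = h *: w + phi x) ->
  derivable f (phi x) w -> derivable (f \o phi) x v.
Proof. by move=> /growth_rate_affine E; rewrite /derivable E. Qed.

Lemma consRV_lift d (t h : R) (y : 'rV[R]_d) j :
  consRV (t, h *: delta_mx 0 j + y) =
  h *: delta_mx 0 (lift ord0 j) + consRV (t, y).
Proof.
apply/rowP => i; have [k ->|->] := unliftP ord0 i; rewrite [in RHS]mxE.
- by rewrite !consRVS/= !mxE (inj_eq lift_inj).
- by rewrite !consRV0/= !mxE /= mulr0 add0r.
Qed.

Lemma consRV_ord0 d (t h : R) (y : 'rV[R]_d) :
  consRV (h *: 1 + t, y) = h *: delta_mx 0 ord0 + consRV (t, y).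
Proof.
apply/rowP => i; have [k ->|->] := unliftP ord0 i; rewrite [in RHS]mxE.
- by rewrite !consRVS/= !mxE /= mulr0 add0r.
- by rewrite !consRV0/= !mxE /=.
Qed.

Lemma partial_consRV d (f : 'rV[R]_d.+1 -> R) t y j :
  partial j (fun y => f (consRV (t, y))) y = partial (lift ord0 j) f (consRV (t, y)).
Proof. by apply: (@derive_affine _ _ f) => h; exact: consRV_lift. Qed.

Lemma consRVr_continuous d t : continuous (fun y : 'rV[R]_d => consRV (t, y)).
Proof.
move=> y; apply: (@continuous_comp _ _ _ (fun y => (t, y)) (@consRV R d)).
  apply: (@cvg_pair _ _ _ (nbhs y) (nbhs t) (nbhs y)); [exact: cvg_cst|exact: cvg_id].
exact: consRV_continuous.
Qed.

Lemma consRVl_continuous d (y : 'rV[R]_d) : continuous (fun t => consRV (t, y)).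
Proof.
move=> t; apply: (@continuous_comp _ _ _ (fun t => (t, y)) (@consRV R d)).
  apply: (@cvg_pair _ _ _ (nbhs t) (nbhs t) (nbhs y)); [exact: cvg_id|exact: cvg_cst].
exact: consRV_continuous.
Qed.

Lemma Ck1_consRV d (f : 'rV[R]_d.+1 -> R) t :
  Ck 1 f -> Ck 1 (fun y => f (consRV (t, y))).
Proof.
move=> [cf df]; split.
  move=> y; apply: (@continuous_comp _ _ _ (fun y => consRV (t, y)) f).
    exact: consRVr_continuous.
  exact: cf.
move=> j; have [dfj [cdf _]] := df (lift ord0 j); split.
  move=> y; apply: (@derivable_affine _ _ f) (dfj _) => h; exact: consRV_lift.
split=> //; rewrite (_ : partial _ _ = partial (lift ord0 j) f \o (fun y => consRV (t, y))).
  move=> y; apply: continuous_comp; first exact: consRVr_continuous.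
  exact: cdf.
by apply/funext => y; exact: partial_consRV.
Qed.

Definition C1 (g : R -> R) :=
  (forall t, derivable g t 1) /\ continuous (fun t => 'D_1 g t).

Lemma derive_consRV0 d (f : 'rV[R]_d.+1 -> R) t y :
  'D_1 (fun t => f (consRV (t, y))) t = partial ord0 f (consRV (t, y)).
Proof. by apply: (@derive_affine _ _ f) => h; exact: consRV_ord0. Qed.

Lemma C1_consRV d (f : 'rV[R]_d.+1 -> R) y :
  Ck 1 f -> C1 (fun t => f (consRV (t, y))).
Proof.
move=> [cf /(_ ord0)[df [cdf _]]]; split.
  move=> t; apply: (@derivable_affine _ _ f) (df _) => h; exact: consRV_ord0.
rewrite (_ : (fun t => 'D_1 (fun t => f (consRV (t, y))) t) =
    partial ord0 f \o (fun t => consRV (t, y))).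
  move=> t; apply: (@continuous_comp _ _ _ (fun t => consRV (t, y)) (partial ord0 f)).
    exact: consRVl_continuous.
  exact: cdf.
by apply/funext => t; exact: derive_consRV0.
Qed.

Lemma C1_FTC (g : R -> R) a b : C1 g -> a < b ->
  (\int[lebesgue_measure]_(t in `[a, b]) ('D_1 g t)%:E = (g b - g a)%:E)%E.
Proof.
move=> [dg cdg] ab; have cg : continuous g.
  by move=> t; apply: differentiable_continuous; exact/derivable1_diffP.
rewrite (@continuous_FTC2 _ (fun t => 'D_1 g t) g)//.
- exact: continuous_subspaceT.
- split; [by move=> t _; exact: dg| |].
    by apply: cvg_at_right_filter; exact: cg.
  by apply: cvg_at_left_filter; exact: cg.
- by move=> t _; rewrite derive1E.
Qed.

Lemma continuous_integrable_itv (g : R -> R) a b : continuous g ->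
  lebesgue_measure.-integrable `[a, b] (EFin \o g).
Proof.
move=> cg; apply: continuous_compact_integrable; first exact: segment_compact.
exact: continuous_subspaceT.
Qed.

(* [g'^2 >= 2 m g' - m^2] with [m] the mean slope, which integrates to
   [(g t - g s)^2 / (t - s)]. *)
Lemma sqr_increment_le_lt (g : R -> R) s t : C1 g -> s < t ->
  (((g t - g s) ^+ 2)%:E <= (t - s)%:E *
    \int[lebesgue_measure]_(u in `[s, t]) (('D_1 g u) ^+ 2)%:E)%E.
Proof.
move=> Cg st; have [dg cdg] := Cg.
have st0 : 0 < t - s by rewrite subr_gt0.
pose m := (g t - g s) / (t - s).
pose k := fun u => 2 * m * g u - m ^+ 2 * u.
have Dk (u : R) : is_derive u 1 k (2 * m * 'D_1 g u - m ^+ 2).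
  have /derivableP dgu := dg u.
  rewrite (_ : k = (2 * m) *: g - (m ^+ 2) *: id); last exact/funext.
  by apply: is_derive_eq; rewrite /GRing.scale/= mulr1.
have Ck : C1 k.
  split=> u; first by have [] := Dk u.
  have -> : (fun t => 'D_1 k t) = (fun u => 2 * m * 'D_1 g u - m ^+ 2).
    by apply/funext => v; have [] := Dk v.
  by apply: cvgB; [apply: cvgMr; exact: cdg|exact: cvg_cst].
have := C1_FTC Ck st.
rewrite (_ : k t - k s = (g t - g s) ^+ 2 / (t - s)); last first.
  by rewrite /k /m; field; rewrite gt_eqF.
move=> kE.
rewrite (_ : (g t - g s) ^+ 2 = (t - s) * ((g t - g s) ^+ 2 / (t - s))); last first.
  by field; rewrite gt_eqF.
rewrite EFinM lee_pmul2l// -kE.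
have csq : continuous (fun u => ('D_1 g u) ^+ 2).
  by move=> u; apply: (@continuous_comp _ _ _ (fun u => 'D_1 g u) (fun x => x ^+ 2));
    [exact: cdg|exact: exprn_continuous].
apply: le_integral => //.
- by apply: continuous_integrable_itv; exact: Ck.2.
- exact: continuous_integrable_itv.
- move=> u _; rewrite lee_fin; have [_ ->] := Dk u.
  by rewrite -subr_ge0 (_ : _ - _ = ('D_1 g u - m) ^+ 2) ?sqr_ge0//; ring.
Qed.

(** Bounding [t - s] by [2a] and enlarging the interval of integration gives a right-hand side
    independent of [s] and [t], as needed when all slices are compared with a fixed one. *)
Lemma sqr_increment_le (g : R -> R) a s t : C1 g -> 0 < a ->
  `|s| <= a -> `|t| <= a ->
  (((g t - g s) ^+ 2)%:E <= (2 * a)%:E *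
    \int[lebesgue_measure]_(u in `[(- a)%R, a]) (('D_1 g u) ^+ 2)%:E)%E.
Proof.
move=> Cg a0; wlog st : s t / s < t => [H sa ta|].
  have [st|ts|->] := ltgtP s t; first exact: H.
    by rewrite -(opprB (g s)) sqrrN; exact: H.
  rewrite subrr expr0n/= mule_ge0//; first by rewrite lee_fin mulr_ge0// ltW.
  by apply: integral_ge0 => u _; rewrite lee_fin sqr_ge0.
rewrite !ler_norml => /andP[sa sa'] /andP[ta ta'].
apply: (le_trans (sqr_increment_le_lt Cg st)).
have csq : continuous (fun u => ('D_1 g u) ^+ 2).
  by move=> u; apply: (@continuous_comp _ _ _ (fun u => 'D_1 g u) (fun x => x ^+ 2));
    [exact: Cg.2|exact: exprn_continuous].
apply: lee_pmul => //.
- by rewrite lee_fin subr_ge0 ltW.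
- by apply: integral_ge0 => u _; rewrite lee_fin sqr_ge0.
- by rewrite lee_fin; lra.
- apply: ge0_subset_integral => //.
  + by apply/measurable_EFinP; apply: measurable_funTS; exact: continuous_measurable_fun.
  + by move=> u _; rewrite lee_fin sqr_ge0.
  + move=> u /=; rewrite !in_itv/= => /andP[h1 h2].
    by rewrite (le_trans sa h1) (le_trans h2 ta').
Qed.

End calculus.

(** * Boxes *)

Section box.
Context (R : realType).

(** Sup-norm balls rather than Euclidean ones: they split as an interval times a box of one
    dimension less, which suits induction on [d]. *)
Definition box d (a : R) : set 'rV[R]_d := [set x : 'rV[R]_d | forall i, `|x 0 i| <= a].

Lemma box_compact d a : compact (@box d a).
Proof.
rewrite (_ : box a = [set x : 'rV[R]_d | forall i, `[(- a), a]%classic (x 0 i)]).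
  by apply: (@rV_compact R d (fun=> `[(- a), a]%classic)) => i; exact: segment_compact.
by apply/seteqP; split => x xa i /=; have := xa i; rewrite /= in_itv/= ler_norml.
Qed.

Lemma box_closed d a : closed (@box d a).
Proof. by apply: compact_closed; [exact: norm_hausdorff|exact: box_compact]. Qed.

Lemma measurable_box d a : measurable (@box d a : set (borelRV R d)).
Proof. by apply: closed_borel; exact: box_closed. Qed.

Lemma box_consRV d a t (y : 'rV[R]_d) :
  box a (consRV (t, y)) <-> `[(- a), a]%classic t /\ box a y.
Proof.
rewrite /= in_itv/= -ler_norml; split=> [xa|[ta ya] i].
  split=> [|i]; first by have := xa ord0; rewrite consRV0.
  by have := xa (lift ord0 i); rewrite consRVS.
by have [k ->|->] := unliftP ord0 i; rewrite ?consRVS ?consRV0//; exact: ya.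
Qed.

Lemma lebRV_box d a : (lebRV R d (@box d a) < +oo)%E.
Proof.
elim: d => [|d IH].
  by rewrite /= diracE; case: (_ \in _); rewrite ltry.
rewrite /= (_ : box a = [set x : 'rV[R]_d.+1 | `[(- a), a]%classic (x 0 ord0) /\
    box a (@rsubmx R 1 1 d x)]).
  rewrite cons_measureX//; last exact: measurable_box.
  rewrite lebesgue_measure_itv/=; case: ifPn => [|_]; last by rewrite mul0e ltry.
  by rewrite lte_fin => aa; rewrite lte_mul_pinfty// lee_fin; lra.
apply/seteqP; split => x /=.
  move=> xa; split => [|i]; first by rewrite in_itv/= -ler_norml; exact: xa.
  by rewrite mxE; exact: xa.
move=> [x0 xa] i; have [k ->|->] := unliftP ord0 i.
  have := xa k; rewrite mxE (_ : rshift 1 k = lift ord0 k)//; exact: val_inj.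
by move: x0; rewrite in_itv/= -ler_norml.
Qed.

Section boxint.
Local Open Scope ereal_scope.
Context d (m : {sigma_finite_measure set (borelRV R d) -> \bar R}) (a : R).
Context (f : 'rV[R]_d.+1 -> \bar R).
Hypotheses (mf : measurable_fun [set: borelRV R d.+1] f) (f0 : forall x, 0 <= f x).

Let restrict_cons t y : (f \_ (box a)) (consRV (t, y)) =
  ((fun t => ((fun y => f (consRV (t, y))) \_ (box a)) y) \_ `[(- a)%R, a]) t.
Proof.
rewrite /patch; have [tya|ntya] := pselect (box a (consRV (t, y))).
  by move/box_consRV: (tya) => [ta ya]; rewrite !mem_set.
rewrite memNset//; case: ifPn => // /set_mem ta; case: ifPn => // /set_mem ya.
by exfalso; apply: ntya; apply/box_consRV.
Qed.

Let mfbox : measurable_fun [set: borelRV R d.+1] (f \_ (box a)).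
Proof.
apply/(measurable_restrictT _ (@measurable_box d.+1 a)).
exact: measurable_funTS.
Qed.

Let fbox0 x : 0 <= (f \_ (box a)) x.
Proof. by rewrite /patch; case: ifP. Qed.

Lemma integral_box_cons : \int[cons_measure m]_(x in box a) f x =
  \int[lebesgue_measure]_(t in `[(- a)%R, a])
    \int[m]_(y in box a) f (consRV (t, y)).
Proof.
rewrite integral_mkcond ge0_integral_cons//.
rewrite [RHS]integral_mkcond; apply: eq_integral => t _.
rewrite [in RHS]/patch; case: ifPn => ta.
  rewrite [RHS]integral_mkcond; apply: eq_integral => y _.
  by rewrite restrict_cons /patch ta.
by apply: integral0_eq => y _; rewrite restrict_cons /patch (negbTE ta).
Qed.

Lemma integral_box_cons_swap : \int[cons_measure m]_(x in box a) f x =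
  \int[m]_(y in box a)
    \int[lebesgue_measure]_(t in `[(- a)%R, a]) f (consRV (t, y)).
Proof.
rewrite integral_mkcond ge0_integral_cons_swap//.
rewrite [RHS]integral_mkcond; apply: eq_integral => y _.
rewrite [in RHS]/patch; case: ifPn => ya.
  rewrite [RHS]integral_mkcond; apply: eq_integral => t _.
  by rewrite restrict_cons /patch ya.
apply: integral0_eq => t _; rewrite restrict_cons /patch (negbTE ya).
by case: ifP.
Qed.

Lemma measurable_integral_box_cons :
  measurable_fun [set: measurableTypeR R] (fun t => \int[m]_(y in box a) f (consRV (t, y))).
Proof.
pose g : measurableTypeR R * borelRV R d -> \bar R :=
  fun p => ((fun y => f (consRV (p.1, y))) \_ (box a)) p.2.
have mg : measurable_fun setT g.
  rewrite (_ : g = (f \o @consRV R d) \_ (snd @^-1` (box a))); last first.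
    apply/funext => -[t y]; rewrite /g /patch/=.
    suff -> : ((t, y) \in snd @^-1` (box a)) = (y \in box a) by [].
    by apply/idP/idP => /set_mem H; apply/mem_set.
  have mS : measurable (snd @^-1` (box a) : set (measurableTypeR R * borelRV R d)).
    rewrite -[X in measurable X]setTI.
    exact: (@measurable_snd _ _ (measurableTypeR R) (borelRV R d) measurableT _ (@measurable_box d a)).
  apply/(measurable_restrictT _ mS); apply: measurable_funTS.
  exact: (measurableT_comp mf (@measurable_consRV R d)).
have g0 p : 0 <= g p by rewrite /g /patch; case: ifP.
rewrite (_ : (fun t => _) = fubini_F m g).
  exact: measurable_fun_fubini_tonelli_F.
by apply/funext => t; rewrite integral_mkcond.
Qed.

Lemma measurable_integral_box_cons_swap :
  measurable_fun [set: borelRV R d]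
    (fun y => \int[lebesgue_measure]_(t in `[(- a)%R, a]) f (consRV (t, y))).
Proof.
pose g : measurableTypeR R * borelRV R d -> \bar R :=
  fun p => ((fun t => f (consRV (t, p.2))) \_ `[(- a)%R, a]) p.1.
have mg : measurable_fun setT g.
  rewrite (_ : g = (f \o @consRV R d) \_ (fst @^-1` `[(- a)%R, a])); last first.
    apply/funext => -[t y]; rewrite /g /patch/=.
    suff -> : ((t, y) \in fst @^-1` `[(- a)%R, a]) = (t \in `[(- a)%R, a]%classic) by [].
    by apply/idP/idP => /set_mem H; apply/mem_set.
  have mS : measurable (fst @^-1` `[(- a)%R, a] : set (measurableTypeR R * borelRV R d)).
    rewrite -[X in measurable X]setTI.
    by apply: (@measurable_fst _ _ (measurableTypeR R) (borelRV R d) measurableT).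
  apply/(measurable_restrictT _ mS); apply: measurable_funTS.
  exact: (measurableT_comp mf (@measurable_consRV R d)).
have g0 p : 0 <= g p by rewrite /g /patch; case: ifP.
rewrite (_ : (fun t => _) = fubini_G lebesgue_measure g).
  exact: measurable_fun_fubini_tonelli_G.
by apply/funext => t; rewrite integral_mkcond.
Qed.

End boxint.
End box.

(** * The Poincare inequality on a box *)

Section poincare.
Context (R : realType).

Lemma continuous_borelE d (f : 'rV[R]_d -> R) : continuous f ->
  measurable_fun [set: borelRV R d] (fun x => (f x)%:E).
Proof. by move=> cf; apply/measurable_EFinP; exact: continuous_borel. Qed.

Lemma measurable_sublevel d (f : 'rV[R]_d -> R) (e : R) : continuous f ->
  measurable ([set x | f x <= e] : set (borelRV R d)).
Proof.
move=> cf; apply: closed_borel.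
rewrite (_ : [set x | _] = f @^-1` [set z | z <= e])//.
by apply: closed_comp => //; exact: closed_le.
Qed.

Lemma Ck1_partial_continuous d (f : 'rV[R]_d -> R) i :
  Ck 1 f -> continuous (partial i f).
Proof. by move=> [_ /(_ i) [_ []]]. Qed.

Lemma Ck1_continuous d (f : 'rV[R]_d -> R) : Ck 1 f -> continuous f.
Proof. by case. Qed.

Lemma energy_continuous d (f : 'rV[R]_d -> R) : Ck 1 f ->
  continuous (fun x => \sum_i partial i f x ^+ 2).
Proof.
move=> Cf; apply: continuous_sum => i; apply: continuous_sqr.
exact: Ck1_partial_continuous.
Qed.

Lemma energy_ge0 d (f : 'rV[R]_d -> R) x : 0 <= \sum_i partial i f x ^+ 2.
Proof. by apply: sumr_ge0 => i _; exact: sqr_ge0. Qed.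

Local Open Scope ereal_scope.

Lemma integral_itv_cst (a B : R) : (0 < a)%R ->
  \int[lebesgue_measure]_(t in `[(- a)%R, a]) B%:E = (2 * a * B)%:E.
Proof.
move=> a0; rewrite integral_cst//= lebesgue_measure_itv/= lte_fin ifT; last lra.
by rewrite -EFinB -EFinM; congr EFin; lra.
Qed.

(* By pigeonhole some slice [x_0 = s] carries at most the average of the
   energy; the induction hypothesis applies there, and the other slices are
   compared with it by the one-dimensional inequality. *)
Lemma poincare_box d a : (0 < a)%R -> exists2 K : R, (0 < K)%R &
  forall f : 'rV[R]_d -> R, Ck 1 f -> forall A : R,
  \int[lebRV R d]_(x in box a) (\sum_i partial i f x ^+ 2)%:E < A%:E ->
  exists y, \int[lebRV R d]_(x in box a) ((f x - f y) ^+ 2)%:E <= (K * A)%:E.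
Proof.
move=> a0; elim: d => [|d [K K0 IH]].
  exists 1%R => // f Cf A EA; exists 0%R; rewrite integral0_eq.
    rewrite mul1r; apply: le_trans (ltW EA).
    by apply: integral_ge0 => x _; rewrite lee_fin energy_ge0.
  by move=> x _; rewrite (thinmx0 x) subrr expr0n.
(* From [(f(t,y) - c)^2 <= 2 (f(t,y) - f(s,y))^2 + 2 (f(s,y) - c)^2], the slice at [t] costs at most
   [4 a A] plus [2 K A / (2a)]; integrating over [t] multiplies both by the length [2a]. *)
exists (8 * a ^+ 2 + 2 * K)%R; first by rewrite addr_gt0// mulr_gt0// exprn_gt0.
move=> f Cf A EA.
have A0 : (0 < A)%R.
  rewrite -lte_fin; apply: le_lt_trans EA.
  by apply: integral_ge0 => x _; rewrite lee_fin energy_ge0.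
have mG := continuous_borelE (energy_continuous Cf).
have G0 x : 0 <= (\sum_i partial i f x ^+ 2)%:E by rewrite lee_fin energy_ge0.
have [s sa sA] : exists2 s, (`|s| <= a)%R &
    \int[lebRV R d]_(y in box a) (\sum_j partial j (fun y => f (consRV (s, y))) y ^+ 2)%:E
      < (A / (2 * a))%:E.
  apply: contrapT => H; move: EA; apply/negP; rewrite -leNgt.
  rewrite integral_box_cons//.
  have <- : \int[lebesgue_measure]_(t in `[(- a)%R, a]) (A / (2 * a))%:E = A%:E.
    by rewrite integral_itv_cst//; congr EFin; field; rewrite gt_eqF.
  apply: ge0_le_integral => //.
  - by move=> t _; rewrite lee_fin divr_ge0// ltW// mulr_gt0.
  - apply: measurable_funTS.
    exact: (@measurable_integral_box_cons _ _ (lebRV R d) a _ mG G0).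
  - move=> t /=; rewrite in_itv/= -ler_norml => ta.
    rewrite leNgt; apply/negP => tA; apply: H; exists t => //.
    apply: le_lt_trans tA; apply: ge0_le_integral.
    + exact: measurable_box.
    + by move=> y _; rewrite lee_fin energy_ge0.
    + apply: measurable_funTS; apply: continuous_borelE.
      by apply: energy_continuous; exact: Ck1_consRV.
    + apply: measurable_funTS.
      exact: (measurableT_comp mG (measurable_consRVr t)).
    + move=> y _; rewrite lee_fin [leRHS]big_ord_recl.
      under eq_bigr do rewrite partial_consRV.
      by rewrite lerDr sqr_ge0.
have [y0 y0A] := IH _ (Ck1_consRV s Cf) _ sA.
exists (consRV (s, y0)); set c := f (consRV (s, y0)).
pose D y := \int[lebesgue_measure]_(u in `[(- a)%R, a]) (partial ord0 f (consRV (u, y)) ^+ 2)%:E.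
have cp0 : continuous (fun x => partial ord0 f x ^+ 2)%R.
  by apply: continuous_sqr; exact: Ck1_partial_continuous.
have mD : measurable_fun [set: borelRV R d] D.
  apply: (@measurable_integral_box_cons_swap _ _ a (fun x => (partial ord0 f x ^+ 2)%:E)).
    exact: continuous_borelE.
  by move=> x; rewrite lee_fin sqr_ge0.
have D0 y : 0 <= D y by apply: integral_ge0 => u _; rewrite lee_fin sqr_ge0.
have DA : \int[lebRV R d]_(y in box a) D y <= A%:E.
  rewrite -(@integral_box_cons_swap _ _ (lebRV R d) a (fun x => (partial ord0 f x ^+ 2)%:E)); last 2 first.
  - exact: continuous_borelE.
  - by move=> x; rewrite lee_fin sqr_ge0.
  apply: le_trans (ltW EA); apply: ge0_le_integral.
  - exact: measurable_box.
  - by move=> y _; rewrite lee_fin sqr_ge0.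
  - by apply: measurable_funTS; exact: continuous_borelE.
  - exact: measurable_funTS.
  - by move=> y _; rewrite lee_fin big_ord_recl lerDl sumr_ge0// => i _; exact: sqr_ge0.
have cfs t : continuous (fun y => (f (consRV (t, y)) - c) ^+ 2)%R.
  apply: continuous_sqr; apply: continuous_subc.
  exact: (Ck1_continuous (Ck1_consRV t Cf)).
have tB t : (`|t| <= a)%R ->
    \int[lebRV R d]_(y in box a) ((f (consRV (t, y)) - c) ^+ 2)%:E <=
    (4 * a * A + 2 * (K * (A / (2 * a))))%:E.
  move=> ta; apply: (@le_trans _ _ (\int[lebRV R d]_(y in box a)
     ((4 * a)%:E * D y + 2%:E * ((f (consRV (s, y)) - c) ^+ 2)%:E))).
    apply: ge0_le_integral.
    - exact: measurable_box.
    - by move=> y _; rewrite lee_fin sqr_ge0.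
    - by apply: measurable_funTS; exact: continuous_borelE.
    - apply: measurable_funTS; apply: emeasurable_funD.
        exact: measurable_funeM.
      by apply: measurable_funeM; exact: continuous_borelE.
    - move=> y _; have := sqr_increment_le (C1_consRV y Cf) a0 sa ta.
      rewrite (_ : \int[_]_(u in _) _ = D y); last first.
        by apply: eq_integral => u _; rewrite derive_consRV0.
      move=> h; apply: (@le_trans _ _ (2%:E * ((2 * a)%:E * D y) +
          2%:E * ((f (consRV (s, y)) - c) ^+ 2)%:E)).
        apply: (@le_trans _ _ (2%:E * ((f (consRV (t, y)) - f (consRV (s, y))) ^+ 2)%:E +
            2%:E * ((f (consRV (s, y)) - c) ^+ 2)%:E)).
          rewrite -!EFinM -EFinD lee_fin.
          rewrite -subr_ge0 (_ : (_ - _)%R = ((f (consRV (t, y)) - f (consRV (s, y))) -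
            (f (consRV (s, y)) - c)) ^+ 2)%R ?sqr_ge0//; ring.
        by rewrite leeD2r// lee_pmul2l.
      by rewrite muleA -EFinM mulrA -natrM.
  rewrite ge0_integralD//=.
  - rewrite ge0_integralZl_EFin//; [|exact: measurable_box|exact: measurable_funTS|by rewrite mulr_ge0// ltW].
    rewrite ge0_integralZl_EFin//; [|exact: measurable_box| |].
    + rewrite (EFinD (4 * a * A)%R) (EFinM (4 * a)%R) (EFinM 2%R).
      by apply: leeD; rewrite lee_pmul2l//= lte_fin mulr_gt0.
    + by move=> y _; rewrite lee_fin sqr_ge0.
    + by apply: measurable_funTS; exact: continuous_borelE.
  - exact: measurable_box.
  - by move=> y _; rewrite mule_ge0// lee_fin mulr_ge0// ltW.
  - by apply: measurable_funTS; exact: measurable_funeM.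
  - by move=> y _; rewrite -EFinM lee_fin mulr_ge0// sqr_ge0.
  - by apply: measurable_funTS; apply: measurable_funeM; exact: continuous_borelE.
have cfc : continuous (fun x => (f x - c) ^+ 2)%R.
  by apply: continuous_sqr; apply: continuous_subc; exact: Ck1_continuous.
rewrite integral_box_cons; last 2 first.
- exact: continuous_borelE.
- by move=> x; rewrite lee_fin sqr_ge0.
apply: (@le_trans _ _ (\int[lebesgue_measure]_(t in `[(- a)%R, a]) (4 * a * A + 2 * (K * (A / (2 * a))))%:E)).
  apply: ge0_le_integral => //.
  - by move=> t _; apply: integral_ge0 => y _; rewrite lee_fin sqr_ge0.
  - apply: measurable_funTS.
    apply: (@measurable_integral_box_cons _ _ (lebRV R d) a
      (fun x => ((f x - c) ^+ 2)%:E)).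
      exact: continuous_borelE.
    by move=> x; rewrite lee_fin sqr_ge0.
  - by move=> t /=; rewrite in_itv/= -ler_norml => ta; exact: tB.
rewrite integral_itv_cst// lee_fin le_eqVlt; apply/orP; left; apply/eqP.
by field; rewrite gt_eqF.
Qed.

End poincare.

(** * Integration of partial derivatives *)

Section ibp.
Context (R : realType).

Lemma derive_outside_closed (V : normedModType R) (G : V -> R) (K : set V) v x :
  closed K -> (forall x, ~ K x -> G x = 0) -> ~ K x -> 'D_v G x = 0.
Proof.
move=> cK G0 nKx; have nearG : {near x, G =1 cst 0}.
  have : nbhs x (~` K) by apply: open_nbhs_nbhs; split => //; exact: closed_openC.
  by apply: filterS => y /G0.
by rewrite (near_eq_derive _ nearG) derive_cst.
Qed.

Lemma continuous_box_bounded d (g : 'rV[R]_d -> R) a : continuous g ->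
  exists2 M : R, 0 < M & forall x, box a x -> `|g x| <= M.
Proof.
move=> cg; have [b0|b0] := pselect (@box R d a !=set0); last first.
  by exists 1 => // x xa; exfalso; apply: b0; exists x.
have [|c _ cmax] := @EVT_max_rV R d (fun x => `|g x|) (box a) b0 (@box_compact _ _ _).
  apply: continuous_subspaceT => x; apply: (@continuous_comp _ _ _ g (fun z : R => `|z|)).
    exact: cg.
  exact: norm_continuous.
exists (`|g c| + 1) => [|x xa]; first by rewrite ltr_wpDl.
by apply: (le_trans (cmax x (mem_set xa))); rewrite lerDl.
Qed.

Lemma integrable_box_support d (g : 'rV[R]_d -> R) a : continuous g ->
  (forall x, ~ box a x -> g x = 0) ->
  (lebRV R d).-integrable [set: borelRV R d] (fun x => (g x)%:E).
Proof.
move=> cg g0; have [M M0 gM] := continuous_box_bounded a cg.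
have cE := continuous_borelE cg.
apply/integrableP; split => //.
apply: (@le_lt_trans _ _ (\int[lebRV R d]_(x in box a) (cst M%:E) x)%E).
  rewrite [leRHS]integral_mkcond; apply: ge0_le_integral => //.
  - exact: measurableT_comp.
  - apply/(measurable_restrictT _ (@measurable_box R d a)).
    exact: measurable_cst.
  - move=> x _; rewrite /patch; case: ifPn => [/set_mem/gM|nx] //=.
    rewrite g0 ?normr0// => xa; move/negP: nx; apply; exact: mem_set.
rewrite integral_cst; last exact: measurable_box.
by rewrite lte_mul_pinfty// ?lebRV_box// lee_fin ltW.
Qed.

Lemma integral_derive_eq0 (g : R -> R) a : 0 < a -> C1 g ->
  (forall t, a < `|t| -> g t = 0) ->
  (\int[lebesgue_measure]_t ('D_1 g t)%:E = 0)%E.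
Proof.
move=> a0 Cg g0.
(* The interval is widened by 1 because [g] is only known to vanish strictly beyond [a], and its
   endpoint values must be zero. *)
have E : (\int[lebesgue_measure]_t ('D_1 g t)%:E =
  \int[lebesgue_measure]_(t in `[(- (a + 1))%R, (a + 1)%R]) ('D_1 g t)%:E)%E.
  rewrite [RHS]integral_mkcond; apply: eq_integral => t _.
  rewrite /patch; case: ifPn => // /negP nt.
  rewrite (@derive_outside_closed _ g `[(- a), a]%classic)//.
  - exact: interval_closed.
  - by move=> x /=; rewrite in_itv/= -ler_norml => /negP; rewrite -ltNge => /g0.
  - rewrite /= in_itv/= => /andP[h1 h2]; apply: nt; apply: mem_set.
    by rewrite /= in_itv/=; apply/andP; split; lra.
rewrite E C1_FTC//; last lra.
by rewrite !g0 ?subrr// ?normrN gtr0_norm; lra.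
Qed.

(** Compact support makes the derivative integrable, so Fubini allows either order. For [i = 0] the
    inner integral in the first coordinate vanishes by the fundamental theorem of calculus;
    otherwise the first coordinate is frozen and the induction hypothesis applies. *)
Lemma integral_partial_eq0 d (G : 'rV[R]_d -> R) (i : 'I_d) a : 0 < a ->
  (forall x, derivable G x (delta_mx 0 i)) -> continuous (partial i G) ->
  (forall x, ~ box a x -> G x = 0) ->
  (\int[lebRV R d]_x (partial i G x)%:E = 0)%E.
Proof.
move=> a0; elim: d G i => [G []//|d IH] G i dG cG G0.
have pG0 x : ~ box a x -> partial i G x = 0.
  move=> nx; rewrite /partial.
  exact: (derive_outside_closed _ (@box_closed R _ a) G0 nx).
have mpG := continuous_borelE cG.
have /integrableP[_ intpG] := integrable_box_support cG pG0.
pose h : measurableTypeR R * borelRV R d -> \bar R :=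
  fun p => (partial i G (consRV p))%:E.
have mh : measurable_fun setT h.
  exact: (measurableT_comp mpG (@measurable_consRV R d)).
have inth : ((@lebesgue_measure R) \x (lebRV R d))%E.-integrable setT h.
  apply/integrableP; split => //; apply: le_lt_trans intpG.
  rewrite [leRHS](ge0_integral_pushforward (@measurable_consRV R d))//.
  exact: measurableT_comp.
rewrite [LHS](@integral_pushforward _ _ _ _ _ _ (@measurable_consRV R d) _ setT)//.
rewrite preimage_setT.
rewrite [LHS](_ : _ = \int[lebesgue_measure \x lebRV R d]_z h z)%E//.
have [j ij|i0] := unliftP ord0 i.
  rewrite -integral12_prod_meas1//; apply: integral0_eq => t _.
  rewrite -[RHS](IH (fun y => G (consRV (t, y))) j).
  - by apply: eq_integral => y _; rewrite partial_consRV /h ij.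
  - move=> y; apply: (@derivable_affine _ _ _ G (fun y => consRV (t, y)) _ _ (delta_mx 0 (lift ord0 j))).
      move=> e; exact: consRV_lift.
    by rewrite -ij.
  - rewrite (_ : partial _ _ = partial i G \o (fun y => consRV (t, y))).
      move=> y; apply: (@continuous_comp _ _ _ (fun y => consRV (t, y)) (partial i G)).
        exact: consRVr_continuous.
      exact: cG.
    by apply/funext => y; rewrite partial_consRV ij.
  - by move=> y ny; apply: G0 => /box_consRV[].
rewrite -integral21_prod_meas1//; apply: integral0_eq => y _.
rewrite -[RHS](@integral_derive_eq0 (fun t => G (consRV (t, y))) a a0).
- by apply: eq_integral => t _; rewrite derive_consRV0 /h i0.
- split.
    move=> t; apply: (@derivable_affine _ _ _ G (fun t => consRV (t, y)) _ _ (delta_mx 0 ord0)).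
      move=> e; exact: consRV_ord0.
    by rewrite -i0.
  rewrite (_ : (fun t => 'D_1 (fun t => G (consRV (t, y))) t) =
      partial i G \o (fun t => consRV (t, y))).
    move=> t; apply: (@continuous_comp _ _ _ (fun t => consRV (t, y)) (partial i G)).
      exact: consRVl_continuous.
    exact: cG.
  by apply/funext => t; rewrite derive_consRV0 i0.
- move=> t ta; apply: G0 => /box_consRV[+ _]; rewrite /= in_itv/= -ler_norml.
  by rewrite leNgt ta.
Qed.

End ibp.

(** * Integrals against a positive density *)

Section weight.
Context (R : realType) (d : nat) (rho : 'rV[R]_d -> R).
Hypotheses (crho : continuous rho) (rho0 : forall x, 0 < rho x).

Let rho_ge0 x : 0 <= rho x. Proof. exact: ltW. Qed.

(** On the compact box [rho] lies between [1/M'] and [M], so passing from Lebesgue measure to [rho]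
    costs the factor [M * M']. The assumption bounds the energy over the whole space, which
    dominates that of the box. *)
Lemma poincare_box_weighted a : 0 < a -> exists2 K : R, 0 < K &
  forall f : 'rV[R]_d -> R, Ck 1 f -> forall A : R,
  (\int[lebRV R d]_x ((\sum_i partial i f x ^+ 2) * rho x)%:E < A%:E)%E ->
  exists y, (\int[lebRV R d]_(x in box a) ((f x - f y) ^+ 2 * rho x)%:E <= (K * A)%:E)%E.
Proof.
move=> a0; have [M M0 rM] := continuous_box_bounded a crho.
have crhoV : continuous (fun x => (rho x)^-1).
  by apply: continuous_invr => // x; rewrite gt_eqF.
have [M' M'0 rM'] := continuous_box_bounded a crhoV.
have [K K0 HK] := poincare_box d a0.
exists (M * K * M') => [|f Cf A EA]; first by rewrite !mulr_gt0.
have cE := energy_continuous Cf.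
have mE := continuous_borelE (continuous_mulr cE crho).
have [|y Hy] := HK f Cf (M' * A).
  apply: (@le_lt_trans _ _ (M'%:E *
    \int[lebRV R d]_(x in box a) ((\sum_i partial i f x ^+ 2) * rho x)%:E)%E); last first.
    rewrite EFinM lte_pmul2l//; apply: le_lt_trans EA.
    apply: ge0_subset_integral => //; first exact: measurable_box.
    by move=> x _; rewrite lee_fin mulr_ge0// energy_ge0.
  rewrite -ge0_integralZl_EFin//; last 4 first.
  - exact: measurable_box.
  - by move=> x _; rewrite lee_fin mulr_ge0// energy_ge0.
  - exact: measurable_funTS.
  - exact: ltW.
  apply: ge0_le_integral.
  - exact: measurable_box.
  - by move=> x _; rewrite lee_fin energy_ge0.
  - by apply: measurable_funTS; exact: continuous_borelE.
  - by apply: measurable_funTS; exact: measurable_funeM.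
  - move=> x /rM' xM; rewrite -EFinM lee_fin mulrCA ler_peMr ?energy_ge0//.
    rewrite -(@ler_pM2r _ (rho x)^-1) ?invr_gt0// mul1r mulfK ?gt_eqF//.
    by apply: le_trans xM; exact: ler_norm.
exists y; rewrite -!mulrA EFinM.
apply: (@le_trans _ _ (M%:E * \int[lebRV R d]_(x in box a) ((f x - f y) ^+ 2)%:E)%E); last first.
  by rewrite lee_pmul2l.
have csq : continuous (fun x => (f x - f y) ^+ 2).
  by apply: continuous_sqr; apply: continuous_subc; exact: Ck1_continuous.
rewrite -ge0_integralZl_EFin//; last 4 first.
- exact: measurable_box.
- by move=> x _; rewrite lee_fin sqr_ge0.
- by apply: measurable_funTS; exact: continuous_borelE.
- exact: ltW.
apply: ge0_le_integral.
- exact: measurable_box.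
- by move=> x _; rewrite lee_fin mulr_ge0// sqr_ge0.
- by apply: measurable_funTS; apply: continuous_borelE; exact: continuous_mulr.
- by apply: measurable_funTS; apply: measurable_funeM; exact: continuous_borelE.
- move=> x /rM xM; rewrite -EFinM lee_fin mulrC ler_wpM2r ?sqr_ge0//.
  by apply: le_trans xM; exact: ler_norm.
Qed.

Lemma measurable_mul_rho (g : 'rV[R]_d -> R) : measurable_fun [set: borelRV R d] g ->
  measurable_fun [set: borelRV R d] (fun x => (g x * rho x)%:E).
Proof.
by move=> mg; apply/measurable_EFinP; apply: measurable_funM => //; exact: continuous_borel.
Qed.

Hypothesis rho1 : (\int[lebRV R d]_x (rho x)%:E = 1)%E.

Lemma integrable_rho : (lebRV R d).-integrable [set: borelRV R d] (fun x => (rho x)%:E).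
Proof.
apply/integrableP; split; first exact: continuous_borelE.
under eq_integral do rewrite /= ger0_norm//.
by rewrite rho1 ltry.
Qed.

Lemma integrable_mul_rho (g : 'rV[R]_d -> R) (M : R) :
  measurable_fun [set: borelRV R d] g -> (forall x, `|g x| <= M) ->
  (lebRV R d).-integrable [set: borelRV R d] (fun x => (g x * rho x)%:E).
Proof.
move=> mg gM; apply: (@le_integrable _ (borelRV R d) R (lebRV R d) setT measurableT
  _ (fun x => (M * rho x)%:E)).
- apply/measurable_EFinP; apply: measurable_funM => //; exact: continuous_borel.
- move=> x _; rewrite lee_fin !normrM ler_wpM2r//.
  by apply: (le_trans (gM x)); exact: ler_norm.
- under eq_fun do rewrite EFinM.
  by apply: integrableZl => //; exact: integrable_rho.
Qed.

Lemma lintR_mul_rho (f : 'rV[R]_d -> R) : continuous f ->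
  lintR (fun x => f x * rho x) = (\int[lebRV R d]_x (f x * rho x)%:E)%E.
Proof.
move=> cf; have mf := continuous_borelE (continuous_mulr cf crho).
rewrite integralE /lintR; congr (_ - _)%E.
  rewrite lint_lebRV.
  - by apply: eq_integral => x _; rewrite funeposE /= EFin_max.
  - under eq_fun do rewrite EFin_max.
    exact: measurable_maxe.
  - by move=> x; rewrite lee_fin le_max lexx orbT.
rewrite lint_lebRV.
- by apply: eq_integral => x _; rewrite funenegE /= EFin_max.
- under eq_fun do rewrite EFin_max.
  apply: measurable_maxe => //; apply: continuous_borelE.
  exact: continuous_oppr (continuous_mulr cf crho).
- by move=> x; rewrite lee_fin le_max lexx orbT.
Qed.

(* [(f - c)^2 - (f - m)^2 = 2 (m - c) f + c^2 - m^2], whose mean is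
   [(m - c)^2] when [m] is the mean of [f]. *)
Lemma dvar_le_center (f : 'rV[R]_d -> R) (c : R) : continuous f ->
  (exists M, forall x, `|f x| <= M) ->
  (dvar rho f <= \int[lebRV R d]_x ((f x - c) ^+ 2 * rho x)%:E)%E.
Proof.
move=> cf [M fM]; set m := dmean rho f.
have intf := integrable_mul_rho (continuous_borel cf) fM.
have Em : (\int[lebRV R d]_x (f x * rho x)%:E = m%:E)%E.
  by rewrite /m /dmean lintR_mul_rho// fineK//; exact: integrable_fin_num.
have csq e : continuous (fun x => (f x - e) ^+ 2).
  by apply: continuous_sqr; exact: continuous_subc.
have intsq e : (lebRV R d).-integrable [set: borelRV R d] (fun x => ((f x - e) ^+ 2 * rho x)%:E).
  apply: (@integrable_mul_rho _ ((M + `|e|) ^+ 2)); first exact: continuous_borel.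
  move=> x; rewrite normrX ler_sqr ?nnegrE//.
    by apply: le_trans (ler_normB _ _) _; rewrite lerD2r.
  by rewrite addr_ge0// (le_trans _ (fM 0)).
rewrite /dvar -/m lint_lebRV; last 2 first.
- by apply: continuous_borelE; exact: continuous_mulr.
- by move=> x; rewrite lee_fin mulr_ge0// sqr_ge0.
rewrite [leRHS](_ : _ = \int[lebRV R d]_x (((f x - m) ^+ 2 * rho x)%:E +
    ((2 * (m - c))%:E * (f x * rho x)%:E + (c ^+ 2 - m ^+ 2)%:E * (rho x)%:E)))%E; last first.
  by apply: eq_integral => x _; rewrite -!EFinM -!EFinD; congr EFin; ring.
have i1 : (lebRV R d).-integrable [set: borelRV R d] (fun x => (2 * (m - c))%:E * (f x * rho x)%:E)%E.
  exact: integrableZl.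
have i2 : (lebRV R d).-integrable [set: borelRV R d] (fun x => (c ^+ 2 - m ^+ 2)%:E * (rho x)%:E)%E.
  by apply: integrableZl => //; exact: integrable_rho.
rewrite integralD//; last exact: integrableD.
rewrite integralD// integralZl// integralZl//; [|exact: integrable_rho].
rewrite Em rho1 leeDl// -EFinM mule1 -EFinD lee_fin.
rewrite (_ : 2 * (m - c) * m + (c ^+ 2 - m ^+ 2) = (m - c) ^+ 2); last by ring.
exact: sqr_ge0.
Qed.

(** Dominated convergence with majorant [rho]. It disposes of every tail below: [1 - cutoff^2],
    complements of boxes and complements of sublevel sets. *)
Lemma mul_rho_cvg0 (g : nat -> 'rV[R]_d -> R) :
  (forall n, measurable_fun [set: borelRV R d] (g n)) ->
  (forall n x, 0 <= g n x <= 1) ->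
  (forall x, g n x @[n --> \oo] --> 0) ->
  forall e, 0 < e -> \forall n \near \oo,
    (\int[lebRV R d]_x (g n x * rho x)%:E <= e%:E)%E.
Proof.
move=> mg g01 g0 e e0.
have [|||||_ _ +] := @dominated_convergence _ (borelRV R d) R (lebRV R d) setT measurableT
  (fun n x => (g n x * rho x)%:E) (cst 0%E) (fun x => (rho x)%:E).
- by move=> n; apply/measurable_EFinP; apply: measurable_funM => //; exact: continuous_borel.
- exact: measurable_cst.
- apply: aeW => x _; apply: cvg_EFin; first exact: nearW.
  rewrite -[X in _ --> X](mul0r (rho x)); apply: cvgMl; exact: g0.
- exact: integrable_rho.
- apply: aeW => x n _; rewrite lee_fin ger0_norm ?mulr_ge0//; last by have /andP[] := g01 n x.
  by rewrite ler_piMl//; have /andP[] := g01 n x.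
rewrite integral0 => /fine_cvgP[ffin /cvgr_lt /(_ e e0) flt].
near=> n; have nfin : (\int[lebRV R d]_x (g n x * rho x)%:E \is a fin_num)%E.
  by near: n; exact: ffin.
rewrite -(fineK nfin) lee_fin ltW//; near: n; exact: flt.
Unshelve. all: by end_near. Qed.

Lemma osc_bounded (f : 'rV[R]_d -> R) : (exists M, forall x, `|f x| <= M) ->
  exists o : R, [/\ 0 <= o, osc f = o%:E & forall x y, `|f x - f y| <= o].
Proof.
move=> [M fM]; pose A := range (fun x => (f x)%:E).
have fA x : A (f x)%:E by exists x.
have supfin : ereal_sup A \is a fin_num.
  rewrite fin_real//; apply/andP; split.
    by apply: lt_le_trans (ereal_sup_ubound (fA 0)); rewrite ltNyr.
  apply: (@le_lt_trans _ _ M%:E); last by rewrite ltry.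
  apply: ge_ereal_sup => _ [x _ <-]; rewrite lee_fin.
  by apply: le_trans (fM x); exact: ler_norm.
have inffin : ereal_inf A \is a fin_num.
  rewrite fin_real//; apply/andP; split.
    apply: (@lt_le_trans _ _ (- M)%:E); first by rewrite ltNyr.
    apply: le_ereal_inf_tmp => _ [x _ <-]; rewrite lee_fin.
    by have := fM x; rewrite ler_norml => /andP[].
  by apply: le_lt_trans (ereal_inf_lbound (fA 0)) _; rewrite ltry.
have fub x : f x <= fine (ereal_sup A).
  by rewrite -lee_fin fineK//; exact: ereal_sup_ubound.
have flb x : fine (ereal_inf A) <= f x.
  by rewrite -lee_fin fineK//; exact: ereal_inf_lbound.
exists (fine (ereal_sup A) - fine (ereal_inf A)); split.
- by rewrite subr_ge0 (le_trans (flb 0))// fub.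
- by rewrite EFinB !fineK.
- by move=> x y; rewrite ler_norml; have := (fub x, fub y, flb x, flb y) => -[[[]]]; lra.
Qed.

End weight.

(** * Chain rules and a radial cutoff *)

Section chain.
Context (R : realType).

(** Only a directional derivative of [q] is given, so everything is restricted to the line
    [h -> h v + x], where the one-variable chain rule applies. *)
Lemma is_derive_comp_real (V : normedModType R) (theta : R -> R) (q : V -> R) x v a b :
  is_derive (q x) 1 theta a -> is_derive x v q b ->
  is_derive x v (fun y => theta (q y)) (a * b).
Proof.
move=> dtheta [dq qb]; pose phi (h : R) := h *: v + x.
have phi0 : phi 0 = x by rewrite /phi scale0r add0r.
have phiE (h : R) : phi (h *: 1 + 0) = h *: v + phi 0.
  by rewrite phi0 addr0 /GRing.scale/= mulr1.
have ds : is_derive (0 : R) 1 (q \o phi) b.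
  split; first by apply: (derivable_affine phiE); rewrite phi0.
  by rewrite (derive_affine _ phiE) phi0.
have dtheta' : is_derive ((q \o phi) 0) 1 theta a by rewrite /= phi0.
have [dts tsE] := is_derive1_comp dtheta' ds.
split.
  apply/derivable1P; move: dts; congr (derivable _ _ _).
rewrite -tsE -[in LHS]phi0.
by rewrite -(derive_affine (fun y => theta (q y)) phiE).
Qed.

Lemma is_derive_mul (V : normedModType R) (f g : V -> R) x v a b :
  is_derive x v f a -> is_derive x v g b ->
  is_derive x v (fun y => f y * g y) (f x * b + g x * a).
Proof. exact: is_deriveM. Qed.

Lemma is_derive_inv (V : normedModType R) (f : V -> R) x v a :
  f x != 0 -> is_derive x v f a ->
  is_derive x v (fun y => (f y)^-1) (- (f x) ^- 2 * a).
Proof.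
by move=> f0 [df <-]; split; [exact: derivableV|exact: deriveV].
Qed.

Lemma Ck1_is_derive d (f : 'rV[R]_d -> R) x i : Ck 1 f ->
  is_derive x (delta_mx 0 i) f (partial i f x).
Proof. by move=> [_ /(_ i)[df _]]; split. Qed.

Lemma Ck1_intro d (f : 'rV[R]_d -> R) (df : 'I_d -> 'rV[R]_d -> R) :
  continuous f -> (forall i, continuous (df i)) ->
  (forall i x, is_derive x (delta_mx 0 i) f (df i x)) ->
  Ck 1 f /\ forall i, partial i f = df i.
Proof.
move=> cf cdf Df; have E i : partial i f = df i.
  by apply/funext => x; have [] := Df i x.
split=> //; split=> // i; split; last by rewrite E.
by move=> x; have [] := Df i x.
Qed.

Lemma is_derive_coord d (x : 'rV[R]_d) i j :
  is_derive x (delta_mx 0 i) (fun y : 'rV[R]_d => y 0 j) ((i == j)%:R : R).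
Proof.
have phiE (h : R) : (h *: delta_mx 0 i + x : 'rV[R]_d) 0 j = h *: (i == j)%:R + x 0 j.
  by rewrite !mxE eqxx/= eq_sym.
split.
  apply: (@derivable_affine _ _ _ id (fun y : 'rV[R]_d => y 0 j) _ _ _ phiE).
  exact: derivable_id.
by rewrite (@derive_affine _ _ _ id (fun y : 'rV[R]_d => y 0 j) _ _ _ phiE) derive_id.
Qed.

(** Squaring the positive part removes its kink: the result is of class C^1, with derivative twice
    the positive part. *)
Definition sqpos (u : R) := Num.max 0 u ^+ 2.

Lemma is_derive_sqpos (u : R) : is_derive u 1 sqpos (2 * Num.max 0 u).
Proof.
have [u0|u0|->] := ltgtP u 0.
- have nu : \forall z \near u, cst 0 z = sqpos z.
    have : nbhs u [set z | z < 0] by apply: open_nbhs_nbhs; split => //; exact: open_lt.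
    by apply: filterS => z z0; rewrite /sqpos max_l ?expr0n// ltW.
  rewrite mulr0; apply: (@near_eq_is_derive _ R R (cst 0) sqpos u 1 0 nu).
- have nu : \forall z \near u, (fun z : R => z * z) z = sqpos z.
    have : nbhs u [set z | 0 < z] by apply: open_nbhs_nbhs; split => //; exact: open_gt.
    by apply: filterS => z z0; rewrite /sqpos max_r ?expr2// ltW.
  apply: (@near_eq_is_derive _ R R (fun z : R => z * z) sqpos u 1 _ nu).
  rewrite (_ : 2 * u = u * 1 + u * 1); last by ring.
  by apply: is_derive_mul; exact: is_derive_id.
(* At the junction point the difference quotient is at most [|h|] in absolute value. *)
have lim0 : h^-1 *: ((sqpos \o shift 0) (h *: 1) - sqpos 0) @[h --> (0 : R)^'] --> (0 : R).
  apply/cvgr0Pnorm_le => e e0; near=> h.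
  rewrite /= /sqpos maxxx expr0n subr0 addr0 /GRing.scale/= mulr1.
  have h0 : h != 0 by near: h; exact: nbhs_dnbhs_neq.
  apply: (@le_trans _ _ `|h|).
    rewrite normrM normrV ?unitfE// normrX ler_pdivrMl ?normr_gt0// -expr2.
    rewrite ler_sqr ?nnegrE//; have [h1|h1] := leP 0 h; first by rewrite lexx.
    by rewrite normr0.
  near: h; apply: dnbhs0_le => //.
rewrite mulr0; split; last exact: cvg_lim lim0.
by apply/cvg_ex; exists 0.
Unshelve. all: by end_near. Qed.

End chain.

Section cutoff.
Context (R : realType) (d : nat).

Definition radial (N : R) (x : 'rV[R]_d) : R := 1 - (\sum_i x 0 i * x 0 i) * (N ^- 2).

(** The square of the positive part of [1 - |x|^2 / N^2]: a C^1 cutoff with explicit derivatives,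
    supported in the Euclidean ball of radius [N] and hence in the box of half-side [N]. *)
Definition cutoff (N : R) (x : 'rV[R]_d) : R := sqpos (radial N x).

Lemma continuous_coord (i : 'I_d) : continuous (fun x : 'rV[R]_d => x 0 i).
Proof. by move=> x; exact: coord_cvg. Qed.

Lemma radial_continuous N : continuous (radial N).
Proof.
have cs : continuous (fun x : 'rV[R]_d => - ((\sum_i x 0 i * x 0 i) * (N ^- 2))).
  apply: continuous_oppr; apply: continuous_mulr; last exact: cst_continuous.
  by apply: continuous_sum => i; apply: continuous_mulr; exact: continuous_coord.
by apply: (@continuous_addr R _ (cst 1)) => //; exact: cst_continuous.
Qed.

Lemma is_derive_radial N (x : 'rV[R]_d) i :
  is_derive x (delta_mx 0 i) (radial N) (- (2 * x 0 i * N ^- 2)).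
Proof.
have Ds : is_derive x (delta_mx 0 i) (\sum_j (fun y : 'rV[R]_d => y 0 j * y 0 j))
    (\sum_j (x 0 j * (i == j)%:R + x 0 j * (i == j)%:R)).
  by apply: is_derive_sum => j; apply: is_derive_mul; exact: is_derive_coord.
have E : radial N = cst 1 - (N ^- 2) *: (\sum_j (fun y : 'rV[R]_d => y 0 j * y 0 j)).
  apply/funext => y; rewrite /radial /= !fctE fct_sumE; congr (_ - _).
  by rewrite /GRing.scale/= mulrC.
rewrite E; apply: is_derive_eq.
rewrite sub0r; congr (- _); rewrite /GRing.scale/= mulrC; congr (_ * _).
rewrite (bigD1 i)//= eqxx big1 ?addr0; first by rewrite mulr1 mulr_natl.
by move=> j ji; rewrite eq_sym (negbTE ji) mulr0 addr0.
Qed.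

Lemma Ck1_cutoff N : Ck 1 (cutoff N) /\
  forall i, partial i (cutoff N) =
    fun x => 2 * Num.max 0 (radial N x) * (- (2 * x 0 i * N ^- 2)).
Proof.
have cm : continuous (fun x => Num.max 0 (radial N x)).
  move=> x; apply: (@continuous_comp _ _ _ (radial N) (fun u => Num.max 0 u)).
    exact: radial_continuous.
  exact: continuous_pos.
apply: Ck1_intro.
- by apply: continuous_sqr.
- move=> i; apply: continuous_mulr.
    by apply: continuous_mulr => //; exact: cst_continuous.
  apply: continuous_oppr; apply: continuous_mulr; last exact: cst_continuous.
  apply: continuous_mulr; first exact: cst_continuous.
  exact: continuous_coord.
- move=> i x; apply: is_derive_comp_real; last exact: is_derive_radial.
  exact: is_derive_sqpos.
Qed.

Lemma radial_le1 N x : 0 < N -> radial N x <= 1.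
Proof.
move=> N0; rewrite /radial gerBl mulr_ge0//.
  by apply: sumr_ge0 => i _; rewrite -expr2 sqr_ge0.
by rewrite invr_ge0 exprn_ge0// ltW.
Qed.

Lemma pos_radial01 N x : 0 < N -> 0 <= Num.max 0 (radial N x) <= 1.
Proof. by move=> N0; rewrite le_max lexx/= ge_max ler01 radial_le1. Qed.

Lemma cutoff01 N x : 0 < N -> 0 <= cutoff N x <= 1.
Proof.
move=> N0; have /andP[h0 h1] := pos_radial01 x N0.
by rewrite /cutoff /sqpos exprn_ge0//= exprn_ile1.
Qed.

Lemma cutoff_out N x : 0 < N -> ~ box N x -> cutoff N x = 0.
Proof.
move=> N0 nx; have [i Ni] : exists i, N < `|x 0 i|.
  apply: contrapT => H; apply: nx => i; rewrite leNgt; apply/negP => Ni.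
  by apply: H; exists i.
rewrite /cutoff /sqpos max_l ?expr0n//.
rewrite /radial subr_le0 ler_pdivlMr ?exprn_gt0// mul1r (bigD1 i)//=.
rewrite -[leLHS]addr0 lerD//.
  by rewrite -expr2 -[leRHS]real_normK ?num_real// ler_sqr ?nnegrE// ltW.
by apply: sumr_ge0 => j _; rewrite -expr2 sqr_ge0.
Qed.

(** With [m] the positive part of [radial N x], the left side equals [(16 / N^2) m^2 |x|^2 / N^2];
    either [m = 0], or [|x|^2 <= N^2] and [m <= 1]. *)
Lemma cutoff_grad N x : 0 < N ->
  \sum_i partial i (cutoff N) x ^+ 2 <= 16 / N ^+ 2.
Proof.
move=> N0; have [_ E] := Ck1_cutoff N; have N20 : 0 < N ^+ 2 by rewrite exprn_gt0.
set m := Num.max 0 (radial N x).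
have /andP[m0 m1] : 0 <= m <= 1 by exact: pos_radial01.
pose s := \sum_i x 0 i * x 0 i.
rewrite (_ : \sum_i _ = 16 / N ^+ 2 * (m ^+ 2 * (s / N ^+ 2))); last first.
  rewrite /s mulr_suml !mulr_sumr; apply: eq_bigr => i _.
  by rewrite E -/m; field; rewrite gt_eqF.
apply: ler_piMr; first by rewrite divr_ge0 ?ltW.
have [r0|r0] := leP (radial N x) 0.
  by rewrite /m max_l// expr0n/= mul0r ler01.
apply: mulr_ile1; rewrite ?exprn_ge0 ?exprn_ile1//.
- apply: divr_ge0; last exact: ltW.
  by apply: sumr_ge0 => i _; rewrite -expr2 sqr_ge0.
- by move: r0; rewrite /radial subr_gt0 => /ltW.
Qed.

Lemma cutoff_cvg (x : 'rV[R]_d) : 1 - cutoff n.+1%:R x ^+ 2 @[n --> \oo] --> (0 : R).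
Proof.
have inv0 : (n.+1%:R ^- 2 : R) @[n --> \oo] --> (0 : R).
  have -> : (fun n => n.+1%:R ^- 2 : R) = (fun n => n.+1%:R^-1 * n.+1%:R^-1).
    by apply/funext => n; rewrite expr2 invfM.
  rewrite -(mulr0 (0 : R)); apply: cvgM; exact: cvg_harmonic.
have rad1 : radial n.+1%:R x @[n --> \oo] --> (1 : R).
  rewrite -[X in _ --> X]subr0; apply: (cvgB (cvg_cst _)).
  rewrite -[X in _ --> X](mulr0 (\sum_i x 0 i * x 0 i)).
  exact: (cvgM (cvg_cst (\sum_i x 0 i * x 0 i)) inv0).
have cut1 : cutoff n.+1%:R x @[n --> \oo] --> (sqpos 1 : R).
  have c1 : sqpos z @[z --> (1 : R)] --> sqpos 1 by apply: continuous_sqr; exact: continuous_pos.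
  exact: (cvg_comp _ _ rad1 c1).
have E : (0 : R) = 1 - sqpos (1 : R) ^+ 2 by rewrite /sqpos max_r ?ler01// !expr1n subrr.
rewrite [X in _ --> X]E; apply: (cvgB (cvg_cst _)).
exact: (cvg_comp _ _ cut1 (@exprn_continuous R 2 _)).
Qed.

End cutoff.

(** * The Lyapunov energy estimate *)

Section lyapunov.
Context (R : realType) (d : nat) (V F psi : 'rV[R]_d -> R) (a B K : R).
Hypotheses (CV : Ck 1 V) (CF : Ck 2 F) (F1 : forall x, 1 <= F x).
Hypotheses (cpsi : continuous psi) (B0 : 0 <= B) (K0 : 0 <= K).
Hypothesis lyap : forall x,
  (laplacian F x - dotp (grad V x) (grad F x)) / F x
    <= - psi x + B * (\1_(box a) x : R).
Hypothesis psiK : forall x, - K * (\1_(box a) x : R) <= psi x.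

Let rho x := expR (- V x).

Let F0 x : 0 < F x. Proof. exact: lt_le_trans (F1 x). Qed.

Let CF1 : Ck 1 F.
Proof.
move: CF => [cF dF]; split=> // i; have [dFi [cFi _]] := dF i.
by split.
Qed.

Let CdF i : Ck 1 (partial i F).
Proof. by have [_ /(_ i)[_]] := CF. Qed.

Lemma rho_continuous : continuous rho.
Proof.
move=> x; apply: (@continuous_comp _ _ _ (fun x => - V x) expR).
  exact: (continuous_oppr (Ck1_continuous CV)).
exact: continuous_expR.
Qed.

Lemma is_derive_rho x i :
  is_derive x (delta_mx 0 i) rho (- partial i V x * rho x).
Proof.
rewrite mulrC.
apply: (@is_derive_comp_real _ _ expR (fun y => - V y)).
by apply: is_deriveN; exact: Ck1_is_derive.
Qed.

Section test_function.
Context (g : 'rV[R]_d -> R) (N : R).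
Hypotheses (N0 : 0 < N) (Cg : Ck 1 g) (g0 : forall x, ~ box N x -> g x = 0).

Let flux i x := rho x * (partial i F x * (g x * g x * (F x)^-1)).

(** Kept in the shape that [is_derive_mul] and [is_derive_inv] return, so that [is_derive_flux]
    needs no algebra; simplification is left to [div_le]. *)
Let dflux i x :=
  rho x * (partial i F x * (g x * g x * (- F x ^- 2 * partial i F x)
    + (F x)^-1 * (g x * partial i g x + g x * partial i g x))
    + g x * g x * (F x)^-1 * partial i (partial i F) x)
  + partial i F x * (g x * g x * (F x)^-1) * (- partial i V x * rho x).

Let is_derive_flux i x : is_derive x (delta_mx 0 i) (flux i) (dflux i x).
Proof.
apply: (is_derive_mul (is_derive_rho x i)).
apply: (is_derive_mul (Ck1_is_derive x i (CdF i))).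
have dg := Ck1_is_derive x i Cg.
apply: (is_derive_mul (is_derive_mul dg dg)).
by apply: (is_derive_inv _ (Ck1_is_derive x i CF1)); rewrite gt_eqF.
Qed.

Let partial_flux i : partial i (flux i) = dflux i.
Proof. by apply/funext => x; have [] := is_derive_flux i x. Qed.

Let cF := Ck1_continuous CF1.
Let cg := Ck1_continuous Cg.
Let cFV : continuous (fun x => (F x)^-1).
Proof. by apply: continuous_invr => // x; rewrite gt_eqF. Qed.

Let dflux_continuous i : continuous (dflux i).
Proof.
have cdF : continuous (partial i F) by exact: Ck1_continuous.
have cddF : continuous (partial i (partial i F)) by exact: Ck1_partial_continuous.
have cdg : continuous (partial i g) by exact: Ck1_partial_continuous.
have cdV : continuous (partial i V) by exact: Ck1_partial_continuous.
have cF2 : continuous (fun x => F x ^- 2).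
  apply: continuous_invr; first exact: continuous_sqr.
  by move=> x; rewrite gt_eqF// exprn_gt0.
by repeat first [exact: rho_continuous | assumption | apply: continuous_addr
  | apply: continuous_mulr | apply: continuous_oppr].
Qed.

Let integral_dflux i : (\int[lebRV R d]_x (dflux i x)%:E = 0)%E.
Proof.
rewrite -partial_flux; apply: (integral_partial_eq0 N0).
- by move=> x; have [] := is_derive_flux i x.
- by rewrite partial_flux.
- by move=> x nx; rewrite /flux g0// !mul0r !mulr0.
Qed.

Let dflux_out i x : ~ box N x -> dflux i x = 0.
Proof. by move=> nx; rewrite /dflux g0//; ring. Qed.

Let div x := \sum_i dflux i x.

(** With [q = grad F / F], the divergence is [rho] times [g^2 (L_V F / F)] plus the sum of
    [2 (d_i g)(g q_i) - (g q_i)^2], and completing the square bounds each summand by [(d_i g)^2].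
    The gradient of [F] thus disappears from the estimate. *)
Let div_le x : div x + Num.max 0 (psi x) * (g x ^+ 2 * rho x) <=
  (\sum_i partial i g x ^+ 2) * rho x +
  (B + K) * (\1_(box a) x * (g x ^+ 2 * rho x)).
Proof.
have r0 : 0 < rho x by exact: expR_gt0.
have Fn0 : F x != 0 by rewrite gt_eqF.
pose q i := partial i F x / F x.
have E : div x = rho x * (g x ^+ 2 * ((laplacian F x - dotp (grad V x) (grad F x)) / F x)
   + \sum_i (2 * partial i g x * (g x * q i) - (g x * q i) ^+ 2)).
  rewrite /div /laplacian /dotp -sumrB mulr_suml mulr_sumr -big_split/= mulr_sumr.
  apply: eq_bigr => i _; rewrite !mxE /dflux /q; field.
  exact: Fn0.
(* By [psiK] the right-hand side is nonnegative, and it is at least [psi x]. Replacing [psi] by its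
   positive part therefore only adds [K] to the coefficient [B] on the box. *)
have pm : Num.max 0 (psi x) <= psi x + K * \1_(box a) x.
  rewrite ge_max; have := psiK x; rewrite mulNr => h.
  by apply/andP; split; [rewrite -lerBlDr sub0r|rewrite lerDl mulr_ge0// indicE].
have S : \sum_i (2 * partial i g x * (g x * q i) - (g x * q i) ^+ 2) <=
    \sum_i partial i g x ^+ 2.
  apply: ler_sum => i _; rewrite -subr_ge0.
  by rewrite (_ : _ - _ = (partial i g x - g x * q i) ^+ 2) ?sqr_ge0//; ring.
have g2 : 0 <= g x ^+ 2 by exact: sqr_ge0.
apply: (@le_trans _ _ (rho x * (g x ^+ 2 * (- psi x + B * \1_(box a) x) +
    \sum_i partial i g x ^+ 2) + (psi x + K * \1_(box a) x) * (g x ^+ 2 * rho x))).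
  rewrite E lerD//.
    by rewrite ler_pM2l// lerD// ler_wpM2l.
  by rewrite ler_wpM2r// mulr_ge0// ltW.
by rewrite le_eqVlt; apply/orP; left; apply/eqP; ring.
Qed.

(* Divergence theorem for the field [rho (g^2 / F) grad F]. *)
Lemma lyapunov_energy :
  (\int[lebRV R d]_x (Num.max 0 (psi x) * (g x ^+ 2 * rho x))%:E <=
   \int[lebRV R d]_x ((\sum_i partial i g x ^+ 2) * rho x)%:E +
   (B + K)%:E * \int[lebRV R d]_(x in box a) (g x ^+ 2 * rho x)%:E)%E.
Proof.
have crho := rho_continuous.
have cg2r : continuous (fun x => g x ^+ 2 * rho x).
  by apply: continuous_mulr => //; exact: continuous_sqr.
have cmax : continuous (fun x => Num.max 0 (psi x)).
  move=> x; apply: (@continuous_comp _ _ _ psi (fun u => Num.max 0 u)).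
    exact: cpsi.
  exact: continuous_pos.
have cP : continuous (fun x => Num.max 0 (psi x) * (g x ^+ 2 * rho x)).
  exact: continuous_mulr.
have cE : continuous (fun x => (\sum_i partial i g x ^+ 2) * rho x).
  by apply: continuous_mulr => //; exact: energy_continuous.
have iP : (lebRV R d).-integrable [set: borelRV R d]
    (fun x => (Num.max 0 (psi x) * (g x ^+ 2 * rho x))%:E).
  apply: (@integrable_box_support _ _ _ N) => // x nx.
  by rewrite g0// expr0n/= mul0r mulr0.
have iD i : (lebRV R d).-integrable [set: borelRV R d] (fun x => (dflux i x)%:E).
  exact: (integrable_box_support (@dflux_continuous i) (@dflux_out i)).
have iS : (lebRV R d).-integrable [set: borelRV R d]
    (fun x => ((\sum_i partial i g x ^+ 2) * rho x)%:E).
  apply: (@integrable_box_support _ _ _ N) => // x nx.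
  rewrite big1 ?mul0r// => i _; rewrite /partial.
  by rewrite (derive_outside_closed _ (@box_closed R _ N) g0 nx) expr0n.
have iG : (lebRV R d).-integrable [set: borelRV R d]
    (fun x => (g x ^+ 2 * rho x)%:E).
  apply: (@integrable_box_support _ _ _ N) => // x nx.
  by rewrite g0// expr0n/= mul0r.
pose Gb := (fun x => (g x ^+ 2 * rho x)%:E) \_ (box a) : 'rV[R]_d -> \bar R.
have iGb : (lebRV R d).-integrable [set: borelRV R d] Gb.
  apply/(integrable_mkcond _ (@measurable_box R d a)).
  by apply: (integrableS measurableT) iG => //; exact: measurable_box.
have int_div : (\int[lebRV R d]_x (\sum_i (dflux i x)%:E) = 0)%E.
  rewrite integral_sum//.
  by rewrite big1// => i _; exact: integral_dflux.
have iDs : (lebRV R d).-integrable [set: borelRV R d] (fun x => \sum_i (dflux i x)%:E)%E.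
  exact: integrable_sum.
(* Adding the divergence, of integral zero, to the left integrand reduces the claim to the pointwise
   inequality [div_le]. *)
rewrite [leLHS](_ : _ = \int[lebRV R d]_x (\sum_i (dflux i x)%:E +
    (Num.max 0 (psi x) * (g x ^+ 2 * rho x))%:E))%E; last first.
  by rewrite integralD// int_div add0e.
rewrite [X in (_ <= _ + _ * X)%E]integral_mkcond -/Gb -integralZl//.
rewrite -integralD//; last exact: integrableZl.
apply: le_integral => //.
- exact: integrableD.
- by apply: integrableD => //; exact: integrableZl.
- move=> x _; rewrite sumEFin -EFinD.
  apply: (@le_trans _ _ ((\sum_i partial i g x ^+ 2) * rho x +
    (B + K) * (\1_(box a) x * (g x ^+ 2 * rho x)))%:E); first by rewrite lee_fin div_le.
  rewrite EFinD leeD2l// EFinM lee_wpmul2l//; first by rewrite lee_fin addr_ge0.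
  by rewrite /Gb /patch indicE; case: ifPn => _; rewrite ?mul1r ?mul0r.
Qed.

End test_function.
End lyapunov.

(** * The variance bound *)

Section core.
Context (R : realType) (d : nat) (V F psi : 'rV[R]_d -> R) (a B K : R).
Hypotheses (CV : Ck 1 V) (CF : Ck 2 F) (F1 : forall x, 1 <= F x).
Hypotheses (cpsi : continuous psi) (B0 : 0 <= B) (K0 : 0 <= K).
Hypothesis lyap : forall x,
  (laplacian F x - dotp (grad V x) (grad F x)) / F x
    <= - psi x + B * (\1_(box a) x : R).
Hypothesis psiK : forall x, - K * (\1_(box a) x : R) <= psi x.

Let rho x := expR (- V x).
Hypothesis rho1 : (\int[lebRV R d]_x (rho x)%:E = 1)%E.

Let crho : continuous rho. Proof. exact: rho_continuous. Qed.
Let rho_gt0 x : 0 < rho x. Proof. exact: expR_gt0. Qed.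
Let rho_ge0 x : 0 <= rho x. Proof. exact: ltW. Qed.

Section test_function.
Context (f : 'rV[R]_d -> R) (o c : R) (A r : R) (kappa : R).
Hypotheses (Cf : Ck 1 f) (o0 : 0 <= o) (r0 : 0 < r).
Hypothesis fo : forall x, `|f x - c| <= o.
Hypothesis EA : (\int[lebRV R d]_x ((\sum_i partial i f x ^+ 2) * rho x)%:E <= A%:E)%E.
Hypothesis boxA : (\int[lebRV R d]_(x in box a) ((f x - c) ^+ 2 * rho x)%:E <= (kappa * A)%:E)%E.

Let N (n : nat) : R := n.+1%:R.
Let N0 n : 0 < N n. Proof. by rewrite /N ltr0n. Qed.
Let g n x := (f x - c) * cutoff (N n) x.

Let CkgP n : Ck 1 (g n) /\ forall i, partial i (g n) =
  fun x => (f x - c) * partial i (cutoff (N n)) x + cutoff (N n) x * partial i f x.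
Proof.
have [Cchi _] := @Ck1_cutoff R d (N n).
have cfc : continuous (fun x => f x - c) by apply: continuous_subc; exact: Ck1_continuous.
have cchi := Ck1_continuous Cchi.
apply: Ck1_intro.
- exact: continuous_mulr.
- move=> i; apply: continuous_addr; apply: continuous_mulr => //; exact: Ck1_partial_continuous.
- move=> i x; apply: is_derive_mul; last exact: Ck1_is_derive.
  rewrite -[X in is_derive _ _ _ X]subr0; apply: is_deriveB; exact: Ck1_is_derive.
Qed.

Let fo2 x : (f x - c) ^+ 2 <= o ^+ 2.
Proof. by rewrite -[leLHS]real_normK ?num_real// ler_sqr ?nnegrE. Qed.

Let cutoff2_01 n (x : 'rV[R]_d) : 0 <= cutoff (N n) x ^+ 2 <= 1.
Proof.
by have /andP[h0 h1] := cutoff01 x (N0 n); rewrite exprn_ge0//= exprn_ile1.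
Qed.

(** The product rule with [(u + v)^2 <= 2 u^2 + 2 v^2]. As [|f - c| <= o], the part carrying the
    gradient of the cutoff is an error that vanishes as [n] grows. *)
Let g_grad n x : \sum_i partial i (g n) x ^+ 2 <=
  2 * (\sum_i partial i f x ^+ 2) + 2 * (o ^+ 2 * (16 / N n ^+ 2)).
Proof.
have [_ E] := CkgP n.
apply: (@le_trans _ _ (2 * (\sum_i partial i f x ^+ 2) +
    2 * (o ^+ 2 * \sum_i partial i (cutoff (N n)) x ^+ 2))); last first.
  by rewrite lerD2l ler_pM2l// ler_wpM2l ?sqr_ge0// cutoff_grad.
rewrite !mulr_sumr -big_split/=; apply: ler_sum => i _; rewrite E.
set p := partial i (cutoff _) x; set q := partial i f x; set u := f x - c.
set chi := cutoff _ x.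
apply: (@le_trans _ _ (2 * (chi ^+ 2 * q ^+ 2) + 2 * (u ^+ 2 * p ^+ 2))).
  rewrite -subr_ge0 (_ : _ - _ = (chi * q - u * p) ^+ 2) ?sqr_ge0//; ring.
have /andP[_ chi1] := cutoff2_01 n x.
by rewrite lerD// ler_pM2l//; [rewrite ler_piMl ?sqr_ge0|rewrite ler_wpM2r ?sqr_ge0//; exact: fo2].
Qed.

(** Where [psi <= 1/r], the bound [o^2] pays for everything. Elsewhere [1 <= r psi], and [(f - c)^2]
    is [g^2] plus the part removed by the truncation. *)
Let split_le n x : (f x - c) ^+ 2 <= r * (Num.max 0 (psi x) * g n x ^+ 2) +
  (o ^+ 2 * \1_[set x | psi x <= r^-1] x + o ^+ 2 * (1 - cutoff (N n) x ^+ 2)).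
Proof.
have /andP[h0 h1] := cutoff2_01 n x.
have h2 : 0 <= o ^+ 2 * (1 - cutoff (N n) x ^+ 2) by rewrite mulr_ge0 ?sqr_ge0// subr_ge0.
have h3 : 0 <= Num.max 0 (psi x) * g n x ^+ 2 by rewrite mulr_ge0 ?sqr_ge0// le_max lexx.
rewrite indicE; have [px|px] := leP (psi x) r^-1.
  rewrite mem_set// mulr1; apply: (le_trans (fo2 x)).
  by rewrite addrCA lerDl addr_ge0// mulr_ge0// ltW.
rewrite memNset; last by apply/negP; rewrite -ltNge.
rewrite mulr0 add0r.
rewrite [leLHS](_ : _ = g n x ^+ 2 + (f x - c) ^+ 2 * (1 - cutoff (N n) x ^+ 2)); last first.
  by rewrite /g; ring.
apply: lerD; last by rewrite ler_wpM2r ?subr_ge0//; exact: fo2.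
rewrite mulrA ler_peMl ?sqr_ge0// max_r; last by rewrite (le_trans _ (ltW px))// invr_ge0 ltW.
by rewrite -ler_pdivrMl// mulr1 ltW.
Qed.

Lemma variance_bound_cutoff n :
  (\int[lebRV R d]_x ((f x - c) ^+ 2 * rho x)%:E <=
   (r * ((2 + (B + K) * kappa) * A))%:E +
   ((o ^+ 2)%:E * \int[lebRV R d]_x (\1_[set x | psi x <= r^-1] x * rho x)%:E +
    ((32 * r * o ^+ 2 / n.+1%:R ^+ 2)%:E +
     (o ^+ 2)%:E * \int[lebRV R d]_x ((1 - cutoff n.+1%:R x ^+ 2) * rho x)%:E)))%E.
Proof.
have [Cg _] := CkgP n; have cg := Ck1_continuous Cg.
have gout x : ~ box (N n) x -> g n x = 0 by move=> nx; rewrite /g cutoff_out// mulr0.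
have BK0 : 0 <= B + K by rewrite addr_ge0.
have cfc2 : continuous (fun x => (f x - c) ^+ 2).
  by apply: continuous_sqr; apply: continuous_subc; exact: Ck1_continuous.
have ccut2 : continuous (fun x : 'rV[R]_d => 1 - cutoff (N n) x ^+ 2).
  apply: continuous_csubr; apply: continuous_sqr; apply: Ck1_continuous.
  by have [] := @Ck1_cutoff R d (N n).
have cmax : continuous (fun x => Num.max 0 (psi x)).
  move=> x; apply: (@continuous_comp _ _ _ psi (fun u => Num.max 0 u)).
    exact: cpsi.
  exact: continuous_pos.
have cg2 : continuous (fun x => g n x ^+ 2) by exact: continuous_sqr.
pose P x := Num.max 0 (psi x) * (g n x ^+ 2 * rho x).
have P0 x : 0 <= P x.
  by apply: mulr_ge0; [rewrite le_max lexx|rewrite mulr_ge0// sqr_ge0].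
have mP : measurable_fun [set: borelRV R d] (fun x => (P x)%:E).
  by apply: continuous_borelE; do 2 apply: continuous_mulr => //.
pose I x : R := \1_[set x | psi x <= r^-1] x * rho x.
have I0 x : 0 <= I x by rewrite mulr_ge0// indicE.
have mI : measurable_fun [set: borelRV R d] (fun x => (I x)%:E).
  by apply: (measurable_mul_rho crho); apply: measurable_indic; exact: measurable_sublevel.
pose J x := (1 - cutoff (N n) x ^+ 2) * rho x.
have J0 x : 0 <= J x by rewrite mulr_ge0// subr_ge0; have /andP[] := cutoff2_01 n x.
have mJ : measurable_fun [set: borelRV R d] (fun x => (J x)%:E).
  by apply: continuous_borelE; exact: continuous_mulr.
have energyg : (\int[lebRV R d]_x ((\sum_i partial i (g n) x ^+ 2) * rho x)%:E <=
    (2 * A + 2 * (o ^+ 2 * (16 / N n ^+ 2)))%:E)%E.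
  set k := 2 * (o ^+ 2 * (16 / N n ^+ 2)).
  have k0 : 0 <= k by rewrite !mulr_ge0 ?sqr_ge0// ?invr_ge0 ?sqr_ge0.
  have cEf : continuous (fun x => (\sum_i partial i f x ^+ 2) * rho x).
    by apply: continuous_mulr => //; exact: energy_continuous.
  have cEg : continuous (fun x => (\sum_i partial i (g n) x ^+ 2) * rho x).
    by apply: continuous_mulr => //; exact: energy_continuous.
  apply: (@le_trans _ _ (\int[lebRV R d]_x (2%:E * ((\sum_i partial i f x ^+ 2) * rho x)%:E +
      k%:E * (rho x)%:E))%E).
    apply: ge0_le_integral => //.
    - by move=> x _; rewrite lee_fin mulr_ge0// energy_ge0.
    - exact: continuous_borelE.
    - by apply: emeasurable_funD; apply: measurable_funeM; exact: continuous_borelE.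
    - move=> x _; rewrite -!EFinM -EFinD lee_fin mulrA -mulrDl ler_wpM2r//.
  rewrite ge0_integralD//; last 4 first.
  - by move=> x _; rewrite -EFinM lee_fin !mulr_ge0// energy_ge0.
  - by apply: measurable_funeM; exact: continuous_borelE.
  - by move=> x _; rewrite -EFinM lee_fin mulr_ge0.
  - by apply: measurable_funeM; exact: continuous_borelE.
  rewrite ge0_integralZl_EFin//; last 2 first.
  - by move=> x _; rewrite lee_fin mulr_ge0// energy_ge0.
  - exact: continuous_borelE.
  rewrite ge0_integralZl_EFin//; last 2 first.
  - by move=> x _; rewrite lee_fin.
  - exact: continuous_borelE.
  rewrite rho1 mule1 (EFinD (2 * A)%R k) leeD2r// EFinM.
  by rewrite lee_pmul2l.
have boxg : (\int[lebRV R d]_(x in box a) (g n x ^+ 2 * rho x)%:E <= (kappa * A)%:E)%E.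
  apply: le_trans boxA; apply: ge0_le_integral.
  - exact: measurable_box.
  - by move=> x _; rewrite lee_fin mulr_ge0// sqr_ge0.
  - by apply: measurable_funTS; apply: continuous_borelE; exact: continuous_mulr.
  - by apply: measurable_funTS; apply: continuous_borelE; exact: continuous_mulr.
  - move=> x _; rewrite lee_fin ler_wpM2r// /g exprMn ler_piMr ?sqr_ge0//.
    by have /andP[] := cutoff2_01 n x.
have PA : (\int[lebRV R d]_x (P x)%:E <=
    (2 * A + 2 * (o ^+ 2 * (16 / N n ^+ 2)) + (B + K) * (kappa * A))%:E)%E.
  apply: (le_trans (lyapunov_energy CV CF F1 cpsi B0 K0 lyap psiK (N0 n) Cg gout)).
  rewrite [leRHS]EFinD; apply: leeD => //.
  by rewrite [leRHS]EFinM lee_wpmul2l.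
apply: (@le_trans _ _ (\int[lebRV R d]_x (r%:E * (P x)%:E +
    ((o ^+ 2)%:E * (I x)%:E + (o ^+ 2)%:E * (J x)%:E)))%E).
  apply: ge0_le_integral => //.
  - by move=> x _; rewrite lee_fin mulr_ge0// sqr_ge0.
  - by apply: continuous_borelE; exact: continuous_mulr.
  - apply: emeasurable_funD; first exact: measurable_funeM.
    by apply: emeasurable_funD; exact: measurable_funeM.
  - move=> x _; rewrite -!EFinM -!EFinD lee_fin /P /I /J.
    rewrite [leRHS](_ : _ = (r * (Num.max 0 (psi x) * g n x ^+ 2) +
      (o ^+ 2 * \1_[set x | psi x <= r^-1] x + o ^+ 2 * (1 - cutoff (N n) x ^+ 2))) * rho x); last by ring.
    by rewrite ler_wpM2r//; exact: split_le.
have o20 : 0 <= o ^+ 2 by exact: sqr_ge0.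
rewrite ge0_integralD//; last 4 first.
- by move=> x _; rewrite -EFinM lee_fin mulr_ge0// ltW.
- exact: measurable_funeM.
- by move=> x _; rewrite -!EFinM -EFinD lee_fin addr_ge0// mulr_ge0.
- by apply: emeasurable_funD; exact: measurable_funeM.
rewrite ge0_integralD//; last 4 first.
- by move=> x _; rewrite -EFinM lee_fin mulr_ge0.
- exact: measurable_funeM.
- by move=> x _; rewrite -EFinM lee_fin mulr_ge0.
- exact: measurable_funeM.
rewrite !ge0_integralZl_EFin//; [|by move=> x _; rewrite lee_fin|
  by move=> x _; rewrite lee_fin|by move=> x _; rewrite lee_fin|exact: ltW].
rewrite [leRHS](addeCA) [X in (_ <= _ + X)%E]addeA -EFinD.
rewrite addeCA leeD2l// leeD2r//.
(* This is [r] times the bound of [PA]. Regrouping the terms in [A] gives the main term; the 32 is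
   the 2 of [g_grad] times the 16 of [cutoff_grad]. *)
apply: (@le_trans _ _ (r%:E * (2 * A + 2 * (o ^+ 2 * (16 / N n ^+ 2)) + (B + K) * (kappa * A))%:E)%E).
  by rewrite lee_pmul2l.
rewrite -EFinM lee_fin le_eqVlt; apply/orP; left; apply/eqP; rewrite -/(N n).
have := lt0r_neq0 (N0 n); move: (N n) => k k0.
by field.
Qed.

Lemma variance_bound :
  (\int[lebRV R d]_x ((f x - c) ^+ 2 * rho x)%:E <=
   (r * ((2 + (B + K) * kappa) * A))%:E +
   (o ^+ 2)%:E * \int[lebRV R d]_x (\1_[set x | psi x <= r^-1] x * rho x)%:E)%E.
Proof.
apply/lee_addgt0Pr => e e0; rewrite -addeA.
have e20 : 0 < e / 2 by rewrite divr_gt0.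
(* The added 1 keeps the denominator positive when [o = 0], that is, for constant [f]. *)
have o1 : 0 < o ^+ 2 + 1 by rewrite ltr_wpDl ?sqr_ge0.
have eo : 0 < e / 2 / (o ^+ 2 + 1) by rewrite divr_gt0.
have [n [n1 n2]] : exists n : nat, 32 * r * o ^+ 2 / n.+1%:R ^+ 2 <= e / 2 /\
    (\int[lebRV R d]_x ((1 - cutoff n.+1%:R x ^+ 2) * rho x)%:E <= (e / 2 / (o ^+ 2 + 1))%:E)%E.
  have H2 : \forall n \near \oo, (\int[lebRV R d]_x ((1 - cutoff n.+1%:R x ^+ 2) * rho x)%:E
      <= (e / 2 / (o ^+ 2 + 1))%:E)%E.
    apply: (@mul_rho_cvg0 _ _ _ crho rho_gt0 rho1 (fun n x => 1 - cutoff n.+1%:R x ^+ 2)) => //.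
    - move=> n; apply: continuous_borel; apply: continuous_csubr; apply: continuous_sqr.
      by apply: Ck1_continuous; have [] := @Ck1_cutoff R d (N n).
    - move=> n x; have /andP[h0 h1] := cutoff2_01 n x.
      by rewrite subr_ge0 h1/= gerBl.
    - exact: cutoff_cvg.
  have H1 : \forall n \near \oo, 32 * r * o ^+ 2 / n.+1%:R ^+ 2 <= e / 2.
    have q0 : 0 < e / 2 / (32 * r * o ^+ 2 + 1).
      by rewrite divr_gt0// ltr_wpDl// !mulr_ge0 ?sqr_ge0// ltW.
    near=> n; have nq : n.+1%:R^-1 < e / 2 / (32 * r * o ^+ 2 + 1).
      by near: n; exact: (near_infty_natSinv_lt (PosNum q0)).
    have k0 : 0 <= 32 * r * o ^+ 2 by rewrite !mulr_ge0 ?sqr_ge0// ltW.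
    apply: (@le_trans _ _ (32 * r * o ^+ 2 * n.+1%:R^-1)).
      apply: ler_wpM2l => //; rewrite lef_pV2 ?posrE ?exprn_gt0 ?ltr0n//.
      by rewrite expr2 ler_peMr// ler1n.
    apply: (@le_trans _ _ ((32 * r * o ^+ 2 + 1) * n.+1%:R^-1)).
      by rewrite ler_wpM2r// ?invr_ge0// lerDl.
    by rewrite mulrC -ler_pdivlMr ?ltW// ltr_wpDl.
  have [m _ /(_ m (leqnn m)) Hm] := filterI H1 H2.
  by exists m.
apply: (le_trans (variance_bound_cutoff n)); rewrite leeD2l// leeD2l//.
rewrite [in leRHS](splitr e) EFinD leeD ?lee_fin//.
apply: (@le_trans _ _ ((o ^+ 2)%:E * (e / 2 / (o ^+ 2 + 1))%:E)%E).
  by rewrite lee_wpmul2l// lee_fin sqr_ge0.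
rewrite -EFinM lee_fin mulrCA ler_piMr ?ltW//.
by rewrite ltr_pdivrMr// mul1r ltrDl.
Unshelve. all: by end_near. Qed.

End test_function.
End core.

(** * From the variance bound to the weak Poincare inequality *)

Section geninv.
Context (R : realType) (h : R -> \bar R).

Lemma geninv_antitone s t : s <= t -> (geninv h t <= geninv h s)%E.
Proof.
move=> st; apply: ereal_inf_le_tmp => _ [r [r0 hr] <-]; exists r => //; split => //.
by apply: (le_trans hr); rewrite lee_fin.
Qed.

Lemma geninv_ge0 s : (0 <= geninv h s)%E.
Proof. by apply: le_ereal_inf_tmp => _ [r [r0 _] <-]; rewrite lee_fin ltW. Qed.

(** The defining infimum need not be attained, so an admissible [r] is only available with some
    slack. *)
Lemma geninv_lt s (e : R) : (geninv h s < e%:E)%E ->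
  exists r, [/\ 0 < r, r < e & (h r <= s%:E)%E].
Proof.
by move=> /ereal_inf_lt[_ [r [r0 hr] <-]]; rewrite lte_fin => re; exists r.
Qed.

End geninv.

Section weak_poincare.
Context (R : realType) (d : nat) (rho psi : 'rV[R]_d -> R) (h : R -> \bar R) (C : R).
Hypotheses (crho : continuous rho) (rho_gt0 : forall x, 0 < rho x).
Hypothesis rho1 : (\int[lebRV R d]_x (rho x)%:E = 1)%E.
Hypotheses (cpsi : continuous psi) (C0 : 0 < C).

Let mu (A : set 'rV[R]_d) := (\int[lebRV R d]_x (\1_A x * rho x)%:E)%E.
Let E (f : 'rV[R]_d -> R) :=
  (\int[lebRV R d]_x ((\sum_i partial i f x ^+ 2) * rho x)%:E)%E.

Hypothesis muh : forall r, 0 < r -> (mu [set x | (psi x <= r^-1)%R] <= h r)%E.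
(** The bound [E f < A] is strict because the choice of a slice in the box inequality is; the energy
    itself is reached by letting [A] decrease to it. *)
Hypothesis var_le : forall (f : 'rV[R]_d -> R) (o A r : R), Ck 1 f ->
  (exists M, forall x, `|f x| <= M) -> (forall x y, `|f x - f y| <= o) ->
  0 < r -> (E f < A%:E)%E ->
  (dvar rho f <= (r * (C * A))%:E + (o ^+ 2)%:E * mu [set x | (psi x <= r^-1)%R])%E.

Let rho_ge0 x : 0 <= rho x. Proof. exact: ltW. Qed.

Lemma denergyE (f : 'rV[R]_d -> R) : Ck 1 f -> denergy rho f = E f.
Proof.
move=> Cf; have E1 x : enorm (grad f x) ^+ 2 = \sum_i partial i f x ^+ 2.
  rewrite /enorm sqr_sqrtr; first by apply: eq_bigr => i _; rewrite mxE.
  by apply: sumr_ge0 => i _; exact: sqr_ge0.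
rewrite /denergy; under [X in lint X]eq_fun do rewrite E1.
rewrite lint_lebRV//.
- by apply: continuous_borelE; apply: continuous_mulr => //; exact: energy_continuous.
- by move=> x; rewrite lee_fin mulr_ge0// energy_ge0.
Qed.

(** Serves the case of rate 0 and infinite energy: their product is 0 by convention, and the whole
    variance must be absorbed by [s * Osc(f)^2] with [1 <= s]. *)
Lemma dvar_le_osc (f : 'rV[R]_d -> R) o : continuous f ->
  (exists M, forall x, `|f x| <= M) -> (forall x y, `|f x - f y| <= o) ->
  (dvar rho f <= (o ^+ 2)%:E)%E.
Proof.
move=> cf fM fo; apply: (le_trans (dvar_le_center crho rho_gt0 rho1 (f 0) cf fM)).
have o0 : 0 <= o by apply: le_trans (fo 0 0).
apply: (@le_trans _ _ (\int[lebRV R d]_x ((o ^+ 2)%:E * (rho x)%:E))%E).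
  apply: ge0_le_integral => //.
  - by move=> x _; rewrite lee_fin mulr_ge0// sqr_ge0.
  - apply: continuous_borelE; apply: continuous_mulr => //.
    by apply: continuous_sqr; exact: continuous_subc.
  - by apply: measurable_funeM; exact: continuous_borelE.
  - move=> x _; rewrite -EFinM lee_fin ler_wpM2r//.
    by rewrite -[leLHS]real_normK ?num_real// ler_sqr ?nnegrE.
rewrite ge0_integralZl_EFin ?rho1 ?mule1//.
- by move=> x _; rewrite lee_fin.
- exact: continuous_borelE.
- exact: sqr_ge0.
Qed.

Lemma mu_setC (A : set 'rV[R]_d) : measurable (A : set (borelRV R d)) ->
  (mu A + mu (~` A) = 1)%E.
Proof.
move=> mA; rewrite /mu -ge0_integralD//.
- rewrite -[RHS]rho1; apply: eq_integral => x _; rewrite -EFinD -mulrDl.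
  by rewrite !indicE in_setC; case: (x \in A); rewrite ?addr0 ?add0r mul1r.
- by move=> x _; rewrite lee_fin mulr_ge0// indicE.
- exact: (measurable_mul_rho crho).
- by move=> x _; rewrite lee_fin mulr_ge0// indicE.
- by apply: (measurable_mul_rho crho); apply: measurable_indic; exact: measurableC.
Qed.

Lemma mu_subset (A B : set 'rV[R]_d) : measurable (A : set (borelRV R d)) ->
  measurable (B : set (borelRV R d)) -> A `<=` B -> (mu A <= mu B)%E.
Proof.
move=> mA mB AB; apply: ge0_le_integral => //.
- by move=> x _; rewrite lee_fin mulr_ge0// indicE.
- exact: (measurable_mul_rho crho).
- exact: (measurable_mul_rho crho).
- move=> x _; rewrite lee_fin ler_wpM2r// !indicE.
  by have [/set_mem/AB xB|] := boolP (x \in A); rewrite ?(mem_set xB)//= ler0n.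
Qed.

Lemma osc_ge0 (f : 'rV[R]_d -> R) o : (forall x y, `|f x - f y| <= o) -> 0 <= o.
Proof. by move=> fo; apply: le_trans (fo 0 0). Qed.

(* The sublevel sets at height [1/r] exhaust the space as [r] tends to 0. *)
Lemma geninv_eq0 s : geninv h s = 0%E -> 1 <= s.
Proof.
move=> h0; apply/ler_addgt0Pr => e e0.
have mS (z : R) : measurable ([set x | psi x <= z] : set (borelRV R d)) by exact: measurable_sublevel.
have [n _ Hn] : \forall n \near \oo, (\int[lebRV R d]_x
    ((\1_(~` [set x | psi x <= n%:R]) x : R) * rho x)%:E <= e%:E)%E.
  apply: (@mul_rho_cvg0 _ _ _ crho rho_gt0 rho1
    (fun n => \1_(~` [set x | psi x <= n%:R]) : 'rV[R]_d -> R)) => //.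
  - by move=> n; apply: measurable_indic; exact: measurableC.
  - by move=> n x; rewrite indicE; case: (x \in _); rewrite ?lexx ler01.
  - move=> x; apply: cvg_near_cst; near=> n; rewrite indicE memNset//.
    rewrite /= => H; apply: H; near: n; exact: nbhs_infty_ger.
(* Since [r < 1/(n+1)], the set [{psi <= n}] lies in [{psi <= 1/r}], of mass at most [h r <= s],
   while the complement of [{psi <= n}] has mass at most [e]. The total mass is 1. *)
have [r [r0 rn hr]] : exists r, [/\ 0 < r, r < n.+1%:R^-1 & (h r <= s%:E)%E].
  by apply: geninv_lt; rewrite h0 lte_fin invr_gt0.
rewrite -lee_fin -(mu_setC (mS n%:R)) EFinD; apply: leeD; last exact: Hn (leqnn n).
apply: le_trans hr; apply: le_trans (muh r0); apply: mu_subset => // x /= xn.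
apply: (le_trans xn); apply: (@le_trans _ _ n.+1%:R); first by rewrite ler_nat.
by rewrite -(invrK n.+1%:R) lef_pV2 ?posrE ?invr_gt0// ltW.
Unshelve. all: by end_near. Qed.

Lemma box_exhaust (x : 'rV[R]_d) : \forall n \near \oo, box n%:R x.
Proof.
near=> n => i; apply: (@le_trans _ _ (\sum_j `|x 0 j|)).
  by rewrite (bigD1 i)//= lerDl sumr_ge0.
by near: n; exact: nbhs_infty_ger.
Unshelve. all: by end_near. Qed.

(** A box carrying almost all the mass is chosen first; zero energy then permits any positive [A] in
    its Poincare inequality, and [A = e/2/K] offsets a constant [K] that depends on the box.
    Outside, [o^2] times a small mass remains. *)
Lemma dvar_energy0 (f : 'rV[R]_d -> R) o : Ck 1 f ->
  (exists M, forall x, `|f x| <= M) -> (forall x y, `|f x - f y| <= o) ->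
  E f = 0%E -> (dvar rho f <= 0)%E.
Proof.
move=> Cf fM fo Ef0; have o0 := osc_ge0 fo; have cf := Ck1_continuous Cf.
apply/lee_addgt0Pr => e e0; rewrite add0e.
have o1 : 0 < o ^+ 2 + 1 by rewrite ltr_wpDl ?sqr_ge0.
have e20 : 0 < e / 2 by rewrite divr_gt0.
have eo : 0 < e / 2 / (o ^+ 2 + 1) by rewrite divr_gt0.
have [n _ Hn] : \forall n \near \oo, (\int[lebRV R d]_x
    ((\1_(~` (box n%:R)) x : R) * rho x)%:E <= (e / 2 / (o ^+ 2 + 1))%:E)%E.
  apply: (@mul_rho_cvg0 _ _ _ crho rho_gt0 rho1
    (fun n => \1_(~` (box n%:R)) : 'rV[R]_d -> R)) => //.
  - by move=> n; apply: measurable_indic; apply: measurableC; exact: measurable_box.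
  - by move=> n x; rewrite indicE; case: (x \in _); rewrite ?lexx ler01.
  - move=> x; apply: cvg_near_cst; near=> n; rewrite indicE memNset//.
    by rewrite /= => H; apply: H; near: n; exact: box_exhaust.
(* Passing from [n] to [n + 1] makes the half-side of the box positive. *)
have {}Hn := Hn _ (leqnSn n); set a : R := n.+1%:R in Hn.
have a0 : 0 < a by rewrite ltr0n.
have [K K0 HK] := poincare_box_weighted crho rho_gt0 a0.
have [|y Hy] := HK f Cf (e / 2 / K); first by rewrite -/(E f) Ef0 lte_fin divr_gt0.
apply: (le_trans (dvar_le_center crho rho_gt0 rho1 (f y) cf fM)).
have cq : continuous (fun x => (f x - f y) ^+ 2 * rho x).
  by apply: continuous_mulr => //; apply: continuous_sqr; exact: continuous_subc.
have q0 x : 0 <= (f x - f y) ^+ 2 * rho x by rewrite mulr_ge0// sqr_ge0.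
have mq := continuous_borelE cq; have mb := @measurable_box R d a.
pose P := ((fun x => ((f x - f y) ^+ 2 * rho x)%:E) \_ (box a)) : 'rV[R]_d -> \bar R.
pose I x := ((\1_(~` (box a)) x : R) * rho x)%:E.
have P0 x : (0 <= P x)%E by rewrite /P /patch; case: ifP => // _; rewrite lee_fin.
have I0 x : (0 <= I x)%E by rewrite lee_fin mulr_ge0// indicE.
have mP : measurable_fun [set: borelRV R d] P.
  by apply/(measurable_restrictT _ mb); exact: measurable_funTS.
have mI : measurable_fun [set: borelRV R d] I.
  by apply: (measurable_mul_rho crho); apply: measurable_indic; exact: measurableC.
apply: (@le_trans _ _ (\int[lebRV R d]_x (P x + (o ^+ 2)%:E * I x))%E).
  apply: ge0_le_integral => //.
  - by move=> x _; rewrite lee_fin.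
  - by apply: emeasurable_funD => //; exact: measurable_funeM.
  - move=> x _; rewrite /P /I /patch indicE in_setC; case: (x \in _) => /=.
      by rewrite mul0r mule0 adde0.
    rewrite mul1r add0e -EFinM lee_fin ler_wpM2r//.
    by rewrite -[leLHS]real_normK ?num_real// ler_sqr ?nnegrE.
rewrite ge0_integralD//; last 2 first.
- by move=> x _; rewrite mule_ge0// lee_fin sqr_ge0.
- exact: measurable_funeM.
rewrite ge0_integralZl_EFin ?sqr_ge0// -integral_mkcond.
rewrite [leRHS](_ : _ = (e / 2)%:E + (e / 2)%:E)%E; last by rewrite -EFinD -splitr.
apply: leeD; first by apply: (le_trans Hy); rewrite mulrC divfK ?gt_eqF.
apply: (@le_trans _ _ ((o ^+ 2)%:E * (e / 2 / (o ^+ 2 + 1))%:E)%E).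
  by rewrite lee_wpmul2l// lee_fin sqr_ge0.
rewrite -EFinM lee_fin mulrCA ler_piMr ?ltW//.
by rewrite ltr_pdivrMr// mul1r ltrDl.
Unshelve. all: by end_near. Qed.

(* The product [beta * energy] is indeterminate when [beta = 0] and the energy
   is infinite (then [1 <= s]) and when [beta = +oo] and the energy vanishes
   (then the variance vanishes). *)
Lemma weak_poincare_geninv : weak_poincare rho (fun s => (C%:E * geninv h s)%E).
Proof.
split=> [s t s0 st|].
  by apply: lee_wpmul2l; [rewrite lee_fin ltW|exact: geninv_antitone].
split=> [s s0|s s0 f sf fM].
  by rewrite mule_ge0 ?geninv_ge0// lee_fin ltW.
have Cf := sf 1; have cf := Ck1_continuous Cf.
have [w [w0 Ew fw]] := osc_bounded fM.
rewrite denergyE// Ew. rewrite -!EFinM -expr2.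
have so0 : (0 <= (s * w ^+ 2)%:E)%E by rewrite lee_fin mulr_ge0 ?sqr_ge0// ltW.
have E0 : (0 <= E f)%E.
  by apply: integral_ge0 => x _; rewrite lee_fin mulr_ge0// energy_ge0.
have Cg0 : (0 <= C%:E * geninv h s)%E by rewrite mule_ge0 ?geninv_ge0// lee_fin ltW.
have [Ef|Efin] := eqVneq (E f) +oo%E.
  have [h0|hn0] := eqVneq (geninv h s) 0%E.
    rewrite h0 mule0 mul0e add0e; apply: (le_trans (dvar_le_osc cf fM fw)).
    by rewrite lee_fin ler_peMl ?sqr_ge0// geninv_eq0.
  rewrite Ef gt0_muley; first by rewrite addye ?leey.
  by rewrite mule_gt0// lt_neqAle eq_sym hn0 geninv_ge0.
have [h1|hfin] := eqVneq (geninv h s) +oo%E.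
  have [Ef0|En0] := eqVneq (E f) 0%E.
    rewrite Ef0 mule0 add0e; apply: le_trans so0.
    exact: dvar_energy0 fw Ef0.
  have Epos : (0 < E f)%E by rewrite lt_neqAle eq_sym En0.
  by rewrite h1 gt0_muley// gt0_mulye// addye ?leey.
have hE : geninv h s = (fine (geninv h s))%:E.
  by rewrite fineK// ge0_fin_numE ?geninv_ge0// lt_neqAle hfin leey.
have EE : E f = (fine (E f))%:E by rewrite fineK// ge0_fin_numE// lt_neqAle Efin leey.
set y := fine (geninv h s) in hE; set z := fine (E f) in EE.
have y0 : 0 <= y by rewrite -lee_fin -hE geninv_ge0.
have z0 : 0 <= z by rewrite -lee_fin -EE.
rewrite hE EE -!EFinM -EFinD.
apply/lee_addgt0Pr => e e0.
have k0 : 0 < C * (y + z + 1) by rewrite mulr_gt0// ltr_wpDl// addr_ge0.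
(* The slack [t] is given to both the inverse [y] and the energy [z]. The excess of
   [(y + t) C (z + t)] over [C y z] is [t C (y + z + t)], at most [t C (y + z + 1) <= e] because
   [t <= 1]. *)
pose t := Num.min 1 (e / (C * (y + z + 1))).
have t0 : 0 < t by rewrite lt_min ltr01 divr_gt0.
have t1 : t <= 1 by rewrite ge_min lexx.
have te : t * (C * (y + z + 1)) <= e.
  by rewrite -ler_pdivlMr// ge_min lexx orbT.
have [r [r0 ry hr]] : exists r, [/\ 0 < r, r < y + t & (h r <= s%:E)%E].
  by apply: geninv_lt; rewrite hE lte_fin ltrDl.
have EA : (E f < (z + t)%:E)%E by rewrite EE lte_fin ltrDl.
apply: (le_trans (var_le Cf fM fw r0 EA)).
apply: (@le_trans _ _ ((r * (C * (z + t)))%:E + (w ^+ 2)%:E * s%:E)%E).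
  rewrite leeD2l// lee_wpmul2l ?lee_fin ?sqr_ge0//.
  by apply: le_trans hr; exact: muh.
rewrite -EFinM -!EFinD lee_fin [w ^+ 2 * s]mulrC addrAC lerD2r.
apply: (@le_trans _ _ ((y + t) * (C * (z + t)))).
  apply: ler_wpM2r; last exact: ltW.
  by apply: mulr_ge0; [exact: ltW|rewrite addr_ge0// ltW].
rewrite (_ : (y + t) * (C * (z + t)) = C * y * z + t * (C * (y + z + t))); last by ring.
rewrite lerD2l; apply: le_trans te; rewrite ler_pM2l// ler_pM2l//.
by rewrite lerD2l.
Qed.

End weak_poincare.

(** * Masses of level sets, and the Lyapunov condition for the perturbed potential *)

Lemma Ck1_add (R : realType) d (f g : 'rV[R]_d -> R) : Ck 1 f -> Ck 1 g ->
  Ck 1 (fun x => f x + g x) /\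
  forall i, partial i (fun x => f x + g x) = fun x => partial i f x + partial i g x.
Proof.
move=> Cf Cg; apply: Ck1_intro.
- by apply: continuous_addr; exact: Ck1_continuous.
- by move=> i; apply: continuous_addr; exact: Ck1_partial_continuous.
- by move=> i x; apply: is_deriveD; exact: Ck1_is_derive.
Qed.

Lemma coord_le_enorm (R : realType) d (x : 'rV[R]_d) i : `|x 0 i| <= enorm x.
Proof.
rewrite /enorm -sqrtr_sqr ler_wsqrtr// (bigD1 i)//= lerDl.
by apply: sumr_ge0 => j _; exact: sqr_ge0.
Qed.

(* [exp(- inf_A U) * nu(A)] is well behaved although the infimum may be [-oo]
   (with junk value [+oo * 0 = 0], hence the null-set case) or taken over the
   empty set. *)
Lemma level_mass_le (R : realType) d (U W : 'rV[R]_d -> R) (A : set 'rV[R]_d) :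
  continuous U -> continuous W -> measurable (A : set (borelRV R d)) ->
  (\int[lebRV R d]_x (\1_A x * expR (- (U x + W x)))%:E <=
   expeR (- ereal_inf [set (U x)%:E | x in A]) * dmeasure (fun x => expR (- W x)) A)%E.
Proof.
move=> cU cW mA.
have cexp (f : 'rV[R]_d -> R) : continuous f -> continuous (fun x => expR (- f x)).
  move=> cf x; apply: (@continuous_comp _ _ _ (fun x => - f x) expR).
    exact: continuous_oppr.
  exact: continuous_expR.
have m1 (f : 'rV[R]_d -> R) : continuous f ->
    measurable_fun [set: borelRV R d] (fun x => (\1_A x * expR (- f x))%:E).
  move=> cf; apply/measurable_EFinP; apply: measurable_funM; first exact: measurable_indic.
  by apply: continuous_borel; exact: cexp.
have cUW : continuous (fun x => U x + W x) by exact: continuous_addr.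
have ind0 (f : 'rV[R]_d -> R) x : (0 <= (\1_A x * expR (- f x))%:E)%E.
  by rewrite lee_fin mulr_ge0 ?expR_ge0// indicE.
rewrite /dmeasure lint_lebRV//; last exact: m1.
set J := (\int[lebRV R d]_x (\1_A x * expR (- W x))%:E)%E.
have J0 : (0 <= J)%E by apply: integral_ge0 => x _; exact: ind0.
set u := ereal_inf _.
have uA x : A x -> (u <= (U x)%:E)%E by move=> Ax; apply: ereal_inf_lbound; exists x.
have [JE|Jn0] := eqVneq J 0%E.
  rewrite JE mule0 le_eqVlt; apply/orP; left; apply/eqP.
  have mJ := m1 _ cW.
  have : (\int[lebRV R d]_x `|(\1_A x * expR (- W x))%:E| = 0)%E.
    by rewrite -[RHS]JE; apply: eq_integral => x _; rewrite gee0_abs.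
  move/(ae_eq_integral_abs _ measurableT mJ) => Hae.
  (* As [expR (- W x)] is positive, a zero integral forces the indicator of [A] to vanish almost
     everywhere, so the left integral is zero as well. *)
  rewrite (ae_eq_integral (cst 0%E))//; [by rewrite integral0|exact: m1|].
  apply: filterS Hae => x /(_ I) [] /eqP; rewrite mulf_eq0 (gt_eqF (expR_gt0 _)) orbF => /eqP H _.
  by rewrite H mul0r.
have Jpos : (0 < J)%E by rewrite lt_neqAle eq_sym Jn0.
(* An infimum [+oo] means that [A] is empty; an infimum [-oo] makes the right-hand side [+oo],
   because [J] is positive here. *)
case Eu : u => [v| |].
- rewrite /= -ge0_integralZl_EFin ?expR_ge0//; last exact: m1.
  apply: ge0_le_integral => //.
  + exact: m1.
  + by apply: measurable_funeM; exact: m1.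
  + move=> x _; rewrite -EFinM lee_fin indicE.
    have [/set_mem Ax|_] := boolP (x \in A); last by rewrite !mul0r mulr0.
    rewrite !mul1r opprD expRD ler_wpM2r ?expR_ge0// ler_expR lerN2.
    by rewrite -lee_fin -Eu; exact: uA.
- rewrite /= mul0e integral0_eq// => x _; rewrite indicE memNset ?mul0r//.
  by move=> /uA; rewrite Eu leye_eq.
- by rewrite /= gt0_mulye// leey.
Qed.

Theorem theorem2p4 (R : realType) (d : nat)
  (W : 'rV[R]_d -> R) (phi F U : 'rV[R]_d -> R) (b Rad : R) :
  (* nu(dx) = e^{-W(x)} dx is a probability measure, W in C^1 *)
  Ck 1 W ->
  lint (fun x => (expR (- W x))%:E) = 1%E ->
  (* Lyapunov condition *)
  0 < b -> 0 < Rad ->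
  continuous phi -> (forall x, 0 < phi x) ->
  Ck 2 F -> (forall x, 1 <= F x) ->
  (forall x, (laplacian F x - dotp (grad W x) (grad F x)) / F x
             <= - phi x + b * (\1_[set y | enorm y < Rad] x : R)) ->
  (* U smooth, mu = e^{-U} nu a probability measure *)
  smooth U ->
  lint (fun x => (expR (- U x) * expR (- W x))%:E) = 1%E ->
  (* phi_U > 0 for |x| large enough *)
  let phiU := fun x => phi x + dotp (grad U x) (grad F x) / F x in
  (exists R0 : R, forall x, R0 <= enorm x -> 0 < phiU x) ->
  let S := fun r : R => [set x | phiU x <= r^-1] in
  let hU := fun r : R =>
    (expeR (- ereal_inf [set (U x)%:E | x in S r])
       * dmeasure (fun x => expR (- W x)) (S r))%E in
  exists C : R, 0 < C /\
    weak_poincare (fun x => expR (- U x) * expR (- W x))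
                  (fun s => (C%:E * geninv hU s)%E).
Proof.
move=> CW _ b0 Rad0 cphi _ CF F1 lyapW sU mu1 phiU [R0 phiU0] S hU.
have CU := sU 1%N.
have [CV dV] := Ck1_add CU CW; set V := fun x => U x + W x in CV dV.
have rhoE : (fun x => expR (- U x) * expR (- W x)) = (fun x => expR (- V x)).
  by apply/funext => x; rewrite -expRD -opprD.
have crho := rho_continuous CV.
have rho_gt0 x : 0 < expR (- V x) by exact: expR_gt0.
have rho1 : (\int[lebRV R d]_x (expR (- V x))%:E = 1)%E.
  rewrite -lint_lebRV; [|exact: continuous_borelE|by move=> x; rewrite lee_fin expR_ge0].
  by rewrite -mu1; congr lint; apply/funext => x; rewrite (congr1 (fun f => f x) rhoE).
have CF1 : Ck 1 F by move: CF => [cF dF]; split=> // i; have [dFi [cFi _]] := dF i.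
have cpsi : continuous phiU.
  apply: continuous_addr => //; apply: continuous_mulr.
    apply: continuous_sum => i.
    under [X in continuous X]eq_fun do rewrite !mxE.
    by apply: continuous_mulr; exact: Ck1_partial_continuous.
  apply: continuous_invr; first exact: Ck1_continuous.
  by move=> x; rewrite gt_eqF// (lt_le_trans _ (F1 x)).
(* Here 1 makes the half-side positive, [R0] makes [phiU] positive off the box, and [Rad] puts the
   ball of the Lyapunov condition inside the box. *)
pose a := Num.max 1 (Num.max R0 Rad).
have a0 : 0 < a by rewrite lt_max ltr01.
have outside x : ~ box a x -> a < enorm x.
  move=> nx; have [i ai] : exists i, a < `|x 0 i|.
    apply: contrapT => H; apply: nx => i; rewrite leNgt; apply/negP => ai.
    by apply: H; exists i.
  exact: lt_le_trans (coord_le_enorm x i).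
have [K K0 HK] := continuous_box_bounded a cpsi.
have psiK x : - K * (\1_(box a) x : R) <= phiU x.
  rewrite indicE; have [/set_mem xa|/negP nx] := boolP (x \in box a).
    by rewrite mulr1; have := HK x xa; rewrite ler_norml => /andP[].
  rewrite mulr0 ltW// phiU0//; have /outside/ltW : ~ box a x by move=> xa; apply: nx; exact: mem_set.
  by apply: le_trans; rewrite !le_max lexx orbT.
(* Replacing [W] by [V = U + W] subtracts [dotp (grad U x) (grad F x) / F x] from the left side,
   which is exactly the change from [phi] to [phiU] on the right. *)
have lyap x : (laplacian F x - dotp (grad V x) (grad F x)) / F x
    <= - phiU x + b * (\1_(box a) x : R).
  have gE : dotp (grad V x) (grad F x) = dotp (grad U x) (grad F x) + dotp (grad W x) (grad F x).
    by rewrite /dotp -big_split/=; apply: eq_bigr => i _; rewrite !mxE dV mulrDl.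
  rewrite gE (_ : (_ - _) / F x = (laplacian F x - dotp (grad W x) (grad F x)) / F x
    - dotp (grad U x) (grad F x) / F x); last by rewrite -mulrBl; congr (_ / _); ring.
  have : b * (\1_[set y | enorm y < Rad] x : R) <= b * (\1_(box a) x : R).
    rewrite ler_pM2l// !indicE; have [/set_mem/= xR|] := boolP (x \in [set y | enorm y < Rad]);
      last by rewrite ler0n.
    rewrite mem_set// => i; apply: (le_trans (coord_le_enorm x i)).
    by apply: (le_trans (ltW xR)); rewrite !le_max lexx !orbT.
  by have := lyapW x; rewrite /phiU; lra.
have [kappa kappa0 Hkappa] := poincare_box_weighted crho rho_gt0 a0.
(* The 2 comes from the gradient of the truncation; [(b + K) * kappa] is the remainder on the box
   after its Poincare inequality. *)
pose C := 2 + (b + K) * kappa.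
have C0 : 0 < C by rewrite ltr_wpDr// mulr_ge0 ?addr_ge0// ltW.
exists C; split=> //; rewrite rhoE.
apply: (@weak_poincare_geninv R d (fun x => expR (- V x)) phiU hU C) => //.
- move=> r r0; apply: level_mass_le; [exact: Ck1_continuous|exact: Ck1_continuous|].
  exact: measurable_sublevel.
- move=> f o A r Cf fM fo r0 EA; have [y Hy] := Hkappa f Cf A EA.
  apply: (le_trans (dvar_le_center crho rho_gt0 rho1 (f y) (Ck1_continuous Cf) fM)).
  apply: (variance_bound CV CF F1 cpsi (ltW b0) (ltW K0) lyap psiK rho1 Cf _ r0 _ (ltW EA) Hy).
    by apply: le_trans (fo 0 0).
  by move=> x; exact: fo.
Qed.
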